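(* Let $\lambda>0$ and assume that $0<p-1<q$, $1<p<2$, and $\sigma\not\equiv 0$ on $\partial S$. Then every solution $u$ of the problem $$\begin{cases} u_t(x,t)=\Delta_{p,\omega}u(x,t)+\lambda|u(x,t)|^{q-1}u(x,t), & (x,t)\in S\times(0,\infty),\\ \mu(z)\frac{\partial u}{\partial_p n}(z,t)+\sigma(z)|u(z,t)|^{p-2}u(z,t)=0, & (z,t)\in\partial S\times[0,\infty),\\ u(x,0)=u_0(x)\ge 0, & x\in\overline S,\end{cases}$$ vanishes in finite time $T$, provided that the initial data $u_0$ is so small that $$\lambda|S|^{\frac12}\left[\sum_{x\in S}u_0^2(x)\right]^{\frac{q-p+1}2}<\lambda_{p,0}.$$
   Context: Network: $G=(V,E)$ is a finite, connected, simple graph with a weight $\omega:V\times V\to[0,\infty)$, i.e. $\omega(x,x)=0$, $\omega(x,y)=\omega(y,x)$, and $\omega(x,y)>0$ iff $x\sim y$ ($x,y$ adjacent). $S$ is a connected induced subgraph of $G$ (identified with its vertex set), $|S|$ is its number of vertices, $\partial S=\{z\in V\setminus S: y\sim z\text{ for some }y\in S\}$, and $\overline S=S\cup\partial S$ is the network whose edges are the edges of $G$ with at least one endpoint in $S$ (so there are no edges between two vertices of $\partial S$ in $\overline S$, and $\omega$ is regarded as $0$ there). Operators, for $u:\overline S\to\mathbb R$, with the convention $|a|^{p-2}a=0$ if $a=0$: $\Delta_{p,\omega}u(x)=\sum_{y\in\overline S}|u(x)-u(y)|^{p-2}[u(y)-u(x)]\omega(x,y)$ for $x\in\overline S$, and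 $\frac{\partial u}{\partial_p n}(z)=\sum_{y\in S}|u(z)-u(y)|^{p-2}[u(z)-u(y)]\omega(z,y)$ for $z\in\partial S$. For functions of $(x,t)$ they act in the variable $x$. Boundary coefficients: $\mu,\sigma:\partial S\to[0,\infty)$ with $\mu(z)+\sigma(z)>0$ for all $z\in\partial S$; $\Gamma=\{z\in\partial S:\mu(z)>0\}$. First eigenvalue: $$\lambda_{p,0}=\min_{u\in\mathcal A}\frac{\frac12\sum_{x,y\in\overline S}|u(x)-u(y)|^p\omega(x,y)+\sum_{z\in\Gamma}\frac{\sigma(z)}{\mu(z)}|u(z)|^p}{\sum_{x\in S}|u(x)|^p},$$ where $\mathcal A=\{u:\overline S\to\mathbb R: u\not\equiv0\text{ in }S,\ u=0\text{ on }\partial S\setminus\Gamma\}$ and the sum over $\Gamma$ is $0$ if $\Gamma=\emptyset$. One has $\lambda_{p,0}>0$ when $\sigma\not\equiv0$. There is a function $\phi_0$ on $\overline S$, positive on $S\cup\Gamma$, with $-\Delta_{p,\omega}\phi_0=\lambda_{p,0}|\phi_0|^{p-2}\phi_0$ on $S$ and $\mu\frac{\partial\phi_0}{\partial_p n}+\sigma|\phi_0|^{p-2}\phi_0=0$ on $\partial S$ (known facts). Solution: a function $u$ on $\overline S\times[0,T_{\max})$, $0<T_{\max}\le\infty$, with $u(x,\cdot)$ continuous on $[0,T_{\max})$ and differentiable in $(0,T_{\max})$ for each $x\in\overline S$, satisfying the problem for times in $[0,T_{\max})$, where $[0,T_{\max})$ is a maximal interval of existence. The solution vanishes in finite time if there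 is a finite $T>0$ in its interval of existence with $\sum_{x\in S}u^2(x,T)=0$. *)

(* Defs.v *)
From HB Require Import structures.
From mathcomp Require Import all_boot all_order all_algebra.
From mathcomp Require Import all_classical all_reals all_analysis.
From mathcomp Require Import lra.
Set Implicit Arguments.
Unset Strict Implicit.
Unset Printing Implicit Defensive.
Import Order.TTheory GRing.Theory Num.Theory.
Import numFieldNormedType.Exports.
Local Open Scope ring_scope.

Record is_network (R : realType) (V : finType) (e : rel V) (w : V -> V -> R)
    : Prop := IsNetwork {
  adj_sym : symmetric e;
  adj_irrefl : irreflexive e;
  adj_connected : forall x y, connect e x y;
  weight_ge0 : forall x y, 0 <= w x y;
  weight_diag : forall x, w x x = 0;
  weight_sym : forall x y, w x y = w y x;
  weight_gt0 : forall x y, (0 < w x y) = e x y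
}.

(* A connected graph is nonempty by convention. *)
Definition connected_induced (V : finType) (e : rel V) (S : {set V}) : Prop :=
  S != finset.set0 /\
  {in S &, forall x y, connect [rel a b | [&& a \in S, b \in S & e a b]] x y}.

Definition boundary (V : finType) (e : rel V) (S : {set V}) : {set V} :=
  [set z in ~: S | [exists y in S, e y z]].

Definition clos (V : finType) (e : rel V) (S : {set V}) : {set V} :=
  S :|: boundary e S.

(* The weight of the network on [clos e S], whose edges are those of the
   ambient graph with at least one endpoint in [S]. *)
Definition clos_weight (R : realType) (V : finType) (w : V -> V -> R)
    (S : {set V}) (x y : V) : R :=
  if (x \in S) || (y \in S) then w x y else 0.

(* |a|^r a is written [`|a| `^ r * a]; the factor [a] makes it 0 at [a = 0]
   for every exponent [r], negative ones included. *)

(* A function on [clos e S] is represented by a function on [V]; its values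
   outside [clos e S] are never used. *)
Definition plaplacian (R : realType) (V : finType) (e : rel V)
    (w : V -> V -> R) (S : {set V}) (p : R) (u : V -> R) (x : V) : R :=
  \sum_(y in clos e S) `|u x - u y| `^ (p - 2) * (u y - u x)
                       * clos_weight w S x y.

Definition pnormal_derivative (R : realType) (V : finType)
    (w : V -> V -> R) (S : {set V}) (p : R) (u : V -> R) (z : V) : R :=
  \sum_(y in S) `|u z - u y| `^ (p - 2) * (u z - u y) * w z y.

Definition Gam (R : realType) (V : finType) (e : rel V) (S : {set V})
    (mu : V -> R) : {set V} :=
  [set z in boundary e S | 0 < mu z].

Definition penergy (R : realType) (V : finType) (e : rel V)
    (w : V -> V -> R) (S : {set V}) (mu sigma : V -> R) (p : R) (u : V -> R)
    : R :=
  2^-1 * (\sum_(x in clos e S) \sum_(y in clos e S)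
            `|u x - u y| `^ p * clos_weight w S x y)
  + \sum_(z in Gam e S mu) sigma z / mu z * `|u z| `^ p.

Definition rayleigh (R : realType) (V : finType) (e : rel V)
    (w : V -> V -> R) (S : {set V}) (mu sigma : V -> R) (p : R) (u : V -> R)
    : R :=
  penergy e w S mu sigma p u / \sum_(x in S) `|u x| `^ p.

Definition admissible (R : realType) (V : finType) (e : rel V) (S : {set V})
    (mu : V -> R) : set (V -> R) :=
  [set u | (exists2 x, x \in S & u x != 0) /\
           {in boundary e S :\: Gam e S mu, forall z, u z = 0}]%classic.

(* The infimum is attained, see [first_eigenvalue_min] below. *)
Definition first_eigenvalue (R : realType) (V : finType) (e : rel V)
    (w : V -> V -> R) (S : {set V}) (mu sigma : V -> R) (p : R) : R :=
  inf [set rayleigh e w S mu sigma p u | u in admissible e S mu]%classic.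

Definition time_interval (R : realType) (Tmax : \bar R) : set R :=
  [set t | 0 <= t /\ (t%:E < Tmax)%E]%classic.

Record is_solution (R : realType) (V : finType) (e : rel V)
    (w : V -> V -> R) (S : {set V}) (mu sigma : V -> R) (p q lambda : R)
    (u0 : V -> R) (Tmax : \bar R) (u : V -> R -> R) : Prop := IsSolution {
  sol_continuous : {in clos e S, forall x,
    {within time_interval Tmax, continuous (u x)}%classic};
  sol_derivable : {in clos e S, forall x (t : R),
    0 < t -> (t%:E < Tmax)%E -> derivable (u x) t 1};
  sol_equation : {in S, forall x (t : R), 0 < t -> (t%:E < Tmax)%E ->
    derive1 (u x) t = plaplacian e w S p (u^~ t) x
                      + lambda * (`|u x t| `^ (q - 1) * u x t)};
  sol_boundary : {in boundary e S, forall z (t : R), 0 <= t -> (t%:E < Tmax)%E ->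
    mu z * pnormal_derivative w S p (u^~ t) z
    + sigma z * (`|u z t| `^ (p - 2) * u z t) = 0};
  sol_initial : {in clos e S, forall x, u x 0 = u0 x}
}.

Definition is_maximal_solution (R : realType) (V : finType) (e : rel V)
    (w : V -> V -> R) (S : {set V}) (mu sigma : V -> R) (p q lambda : R)
    (u0 : V -> R) (Tmax : \bar R) (u : V -> R -> R) : Prop :=
  [/\ (0 < Tmax)%E,
      is_solution e w S mu sigma p q lambda u0 Tmax u &
      forall (T' : \bar R) (v : V -> R -> R), (Tmax < T')%E ->
        is_solution e w S mu sigma p q lambda u0 T' v ->
        ~ {in clos e S, forall x (t : R), time_interval Tmax t -> v x t = u x t}].

Definition vanishes_in_finite_time (R : realType) (V : finType)
    (S : {set V}) (Tmax : \bar R) (u : V -> R -> R) : Prop :=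
  exists T : R,
    [/\ 0 < T, (T%:E < Tmax)%E & \sum_(x in S) u x T ^+ 2 = 0].

Section FirstEigenvalueMin.
Local Open Scope classical_set_scope.

Let powR_norm_continuous (R : realType) (p : R) : 0 < p ->
  continuous (fun a : R => `|a| `^ p).
Proof.
move=> p0 a; have [->|a0] := eqVneq a 0.
  apply/(@cvgrPdist_lt _ R^o) => eps eps0 /=.
  near=> x.
  rewrite normr0 powR0 ?gt_eqF// sub0r normrN ger0_norm ?powR_ge0//.
  have -> : eps = (eps `^ p^-1) `^ p by rewrite -powRrM mulVf ?gt_eqF// powRr1// ltW.
  apply: gt0_ltr_powR; rewrite ?nnegrE ?powR_ge0//.
  near: x; apply: (@nbhs0_lt _ R^o); exact: powR_gt0.
apply: (@continuous_comp _ _ _ (fun x : R => `|x|) (fun x => x `^ p)).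
  exact: (@norm_continuous _ R^o).
apply/differentiable_continuous/derivable1_diffP/derivable_powR.
have h : 0 < `|a : R| by rewrite normr_gt0.
have h2 : (`|a : R| : R) \in `]0, +oo[%R by rewrite in_itv /= h.
exact: h2.
Unshelve. all: by end_near. Qed.

(* Truncation at -1 and 1 does not increase the energy, so the minimization
   can be restricted to a compact cube. *)
Let clamp (R : realType) (a : R) : R := Num.max (-1) (Num.min 1 a).

Let clamp_id (R : realType) (a : R) : `|a| <= 1 -> clamp a = a.
Proof.
rewrite ler_norml => /andP[h1 h2].
by rewrite /clamp min_r// max_r.
Qed.

Let clampP (R : realType) (a : R) :
  [\/ clamp a = -1 /\ a <= -1, clamp a = a /\ -1 <= a <= 1 |
      clamp a = 1 /\ 1 <= a].
Proof.
have [a1|a1] := leP 1 a.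
  by apply: Or33; rewrite /clamp min_l// max_r//; lra.
have [a2|a2] := leP a (-1).
  by apply: Or31; rewrite /clamp min_r ?ltW// max_l.
by apply: Or32; rewrite clamp_id ?ler_norml ?(ltW a1) ?(ltW a2).
Qed.

Let clamp_itv (R : realType) (a : R) : -1 <= clamp a <= 1.
Proof. by have [[-> ?]|[-> //]|[-> ?]] := clampP a; apply/andP; split; lra. Qed.

Let clamp_lip (R : realType) (a b : R) : `|clamp a - clamp b| <= `|a - b|.
Proof.
wlog ab : a b / b <= a.
  by move=> H; have [/H//|/ltW/H] := leP b a; rewrite distrC (distrC b).
rewrite [leRHS]ger0_norm ?subr_ge0// ler_norml.
by have [[-> ?]|[-> /andP[? ?]]|[-> ?]] := clampP a;
  have [[-> ?]|[-> /andP[? ?]]|[-> ?]] := clampP b; apply/andP; split; lra.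
Qed.

Lemma first_eigenvalue_min (R : realType) (V : finType) (e : rel V)
    (w : V -> V -> R) (S : {set V}) (mu sigma : V -> R) (p : R) :
  is_network e w -> S != finset.set0 ->
  {in boundary e S, forall z, 0 <= sigma z} -> 0 < p ->
  exists2 u, admissible e S mu u &
    rayleigh e w S mu sigma p u = first_eigenvalue e w S mu sigma p /\
    forall v, admissible e S mu v ->
      rayleigh e w S mu sigma p u <= rayleigh e w S mu sigma p v.
Proof.
move=> hG S0 hsigma p0.
pose D := boundary e S :\: Gam e S mu.
pose E := penergy e w S mu sigma p.
pose N (u : V -> R) := \sum_(x in S) `|u x| `^ p.
have wge0 x y : 0 <= clos_weight w S x y.
  by rewrite /clos_weight; case: ifP => // _; exact: weight_ge0 hG x y.
have smge0 z : z \in Gam e S mu -> 0 <= sigma z / mu z.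
  by rewrite inE => /andP[zb mz]; rewrite divr_ge0 ?hsigma// ltW.
have Emono u v : (forall x, `|v x| <= `|u x|) ->
    (forall x y, `|v x - v y| <= `|u x - u y|) -> E v <= E u.
  move=> h1 h2; apply: lerD.
    rewrite ler_pM2l//; apply: ler_sum => x _; apply: ler_sum => y _.
    by apply: ler_wpM2r => //; apply: ge0_ler_powR; rewrite ?nnegrE// ltW.
  apply: ler_sum => z zG; apply: ler_wpM2l; first exact: smge0.
  by apply: ge0_ler_powR; rewrite ?nnegrE// ltW.
have Escale s u : 0 <= s -> E (fun x => s * u x) = s `^ p * E u.
  move=> s0; rewrite /E /penergy mulrDr mulrCA; congr (_ * _ + _).
    rewrite mulr_sumr; apply: eq_bigr => x _; rewrite mulr_sumr; apply: eq_bigr => y _.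
    by rewrite -mulrBr normrM (ger0_norm s0) powRM// mulrA.
  rewrite mulr_sumr; apply: eq_bigr => z _.
  by rewrite normrM (ger0_norm s0) powRM// mulrCA.
have Npos u : admissible e S mu u -> 0 < N u.
  move=> [[x xS ux] _]; rewrite /N (bigD1 x)//= ltr_wpDr ?sumr_ge0//.
  by rewrite powR_gt0 // normr_gt0.
pose A : set (prod_topology (fun _ : V => R)) :=
  [set u | (forall x, (if x \in D then [set 0] else `[-1, 1]%classic) (u x))]
  `&` N @^-1` [set 1].
have Nproj (c : R -> R) (f : prod_topology (fun _ : V => R) -> R) :
    continuous c -> continuous f -> continuous (c \o f).
  by move=> cc cf u; apply: continuous_comp; [exact: cf|exact: cc].
have pc x : continuous (fun u : prod_topology (fun _ : V => R) => u x : R).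
  exact: (@proj_continuous V (fun=> R) x).
have sumc (B : {set V}) (f : V -> prod_topology (fun _ : V => R) -> R) :
    (forall x, continuous (f x)) ->
    continuous (fun u => \sum_(x in B) f x u).
  move=> cf u.
  have := @cvg_big R V +%R 0 [in B] (@add_continuous R) _ (nbhs u)
    (index_enum V) f (f^~ u).
  by move=> /(_ _ (fun x _ => cf x u)).
have Nc : continuous (N : prod_topology (fun _ : V => R) -> R).
  apply: sumc => x.
  by apply: (Nproj (fun a => `|a| `^ p)) => //; exact: powR_norm_continuous.
have mulc (c : R) (f : prod_topology (fun _ : V => R) -> R) :
    continuous f -> continuous (fun u => c * f u).
  by move=> cf u; exact: (cvgM (cvg_cst c) (cf u)).
have mulcr (c : R) (f : prod_topology (fun _ : V => R) -> R) :
    continuous f -> continuous (fun u => f u * c).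
  by move=> cf u; exact: (cvgM (cf u) (cvg_cst c)).
have addc (f g : prod_topology (fun _ : V => R) -> R) :
    continuous f -> continuous g -> continuous (fun u => f u + g u).
  by move=> cf cg u; exact: (cvgD (cf u) (cg u)).
have Ec : continuous (E : prod_topology (fun _ : V => R) -> R).
  apply: addc.
    apply: mulc; apply: (sumc) => x; apply: (sumc) => y.
    apply: mulcr; apply: (Nproj (fun a => `|a| `^ p)).
      exact: powR_norm_continuous.
    by move=> u; exact: (cvgB (pc x u) (pc y u)).
  apply: sumc => z; apply: mulc.
  by apply: (Nproj (fun a => `|a| `^ p)) => //; exact: powR_norm_continuous.
have Acomp : compact A.
  apply: compact_closedI.
    apply: (@tychonoff V (fun=> R)
      (fun x => if x \in D then [set 0] else `[-1, 1])) => x; case: ifP => _.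
      exact: compact_set1.
    exact: segment_compact.
  by apply: preimage_closed => //; exact: closed_eq.
have DS x : x \in D -> x \notin S.
  by rewrite !inE => /andP[_] /andP[].
have Aadm u : A u -> admissible e S mu u.
  move=> [h hN]; split; last by move=> x xD; have := h x; rewrite xD.
  apply: contrapT => h0; move: hN; rewrite /= /N big1 => [/eqP|x xS].
    by rewrite eq_sym oner_eq0.
  have [->|ux] := eqVneq (u x) 0; first by rewrite normr0 powR0// gt_eqF.
  by case: h0; exists x.
have red v : admissible e S mu v ->
    exists2 v', A v' & E v' <= rayleigh e w S mu sigma p v.
  move=> va; have Nv := Npos _ va.
  pose s := N v `^ (- p^-1).
  have s0 : 0 <= s by exact: powR_ge0.
  have sp : s `^ p = (N v)^-1.
    by rewrite -powRrM mulNr mulVf ?gt_eqF// powR_inv1// ltW.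
  have Ns : N (fun x => s * v x) = 1.
    rewrite /N; under eq_bigr do rewrite normrM (ger0_norm s0) powRM//.
    by rewrite -mulr_sumr sp mulVf// gt_eqF.
  have le1 x : x \in S -> `|s * v x| <= 1.
    move=> xS; rewrite leNgt; apply/negP => h.
    have h1 : 1 `^ p < `|s * v x| `^ p by apply: gt0_ltr_powR; rewrite ?nnegrE.
    suff : N (fun x => s * v x) > 1 by rewrite Ns ltxx.
    rewrite powR1 in h1; apply: (lt_le_trans h1).
    by rewrite /N (bigD1 x)//= lerDl sumr_ge0.
  exists (fun x => clamp (s * v x)).
    split=> [x|]; last first.
      rewrite /= -Ns; apply: eq_bigr => x xS; rewrite clamp_id//; exact: le1.
    case: ifP => xD; last by exact: clamp_itv.
    by rewrite /= (va.2 _ xD) mulr0 clamp_id// normr0.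
  have -> : rayleigh e w S mu sigma p v = E (fun x => s * v x).
    by rewrite Escale// sp mulrC.
  apply: Emono => x; last by move=> y; exact: clamp_lip.
  have := clamp_lip (s * v x) 0.
  by rewrite (@clamp_id _ 0) ?normr0// !subr0.
have A0 : A !=set0.
  case/set0Pn: S0 => x xS.
  have adm : admissible e S mu (fun y => (y == x)%:R).
    split; first by exists x; rewrite // eqxx oner_neq0.
    move=> z zD; case: eqP => // zx; move: (DS _ zD).
    by rewrite zx xS.
  by have [v' Av' _] := red _ adm; exists v'.
have [c] := compact_EVT_min A0 Acomp (continuous_subspaceT Ec).
rewrite inE => Ac cmin.
have cle v : admissible e S mu v ->
    rayleigh e w S mu sigma p c <= rayleigh e w S mu sigma p v.
  move=> /red[v' Av' Ev']; apply: le_trans Ev'.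
  have -> : rayleigh e w S mu sigma p c = E c.
    by rewrite /rayleigh -/(N c) Ac.2 divr1.
  by apply: cmin; rewrite inE.
exists c; first exact: Aadm.
split=> //; apply/eqP; rewrite eq_le; apply/andP; split.
  apply: lb_le_inf; first by eexists; exists c; [exact: Aadm|].
  by move=> _ [v va <-]; exact: cle.
apply: ge_inf; last by exists c; [exact: Aadm|].
by exists (rayleigh e w S mu sigma p c) => _ [v va <-]; exact: cle.
Qed.

End FirstEigenvalueMin.

(* Main.v *)
Require Import Defs.
From HB Require Import structures.
From mathcomp Require Import all_boot all_order all_algebra.
From mathcomp Require Import all_classical all_reals all_analysis.
From mathcomp Require Import lra ring.
Import Order.TTheory GRing.Theory Num.Theory.
Import numFieldNormedType.Exports.
Local Open Scope ring_scope.

Set Implicit Arguments.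
Unset Strict Implicit.

(** Write Y(t) for the sum over S of the u(x,t)^2, and P(t) for the sum over S
    of the |u(x,t)|^p.

    Extinction comes from a differential inequality for Y.  By Green's formula
    and the boundary condition, pairing u with its p-Laplacian over S gives
    minus the energy of u ([green_energy]), and the energy is at least
    lambda_{p,0} P ([rayleigh_bound]).  Every |u(x,t)| is at most Y^(1/2), so
    the reaction term contributes at most lambda Y^((q-p+1)/2) P, and
      Y' <= - 2 (lambda_{p,0} - lambda Y^((q-p+1)/2)) P
    ([sumsq_dissipation]).  As |S| >= 1, the smallness assumption makes the
    bracket positive at time 0; Y cannot increase while the bracket is positive,
    so the bracket keeps its initial lower bound ([sumsq_le]).  Since p < 2, the
    same pointwise bound gives Y <= Y^((2-p)/2) P.  Therefore Y^((2-p)/2)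
    decreases at least at a fixed linear rate as long as Y > 0
    ([sumsq_powR_decay]), and must reach 0 in finite time ([extinction]).

    This needs the solution to live long enough, whereas a maximal solution
    could a priori stop before its extinction time.  It does not, because Y, and
    with it u on S, stays bounded, and a bounded solution on a finite interval
    [0,T) extends beyond T ([bounded_solution_extends]).  The problem is an
    ordinary differential system on S coupled to an algebraic condition at each
    boundary vertex, with nonlinearities that are only Hoelder continuous.  The
    boundary condition at z says that u(z) is the unique zero of
      s |-> mu(z) sum_{y in S} psi(s - u(y)) w(z,y) + sigma(z) psi(s),
    psi(a) = |a|^(p-2) a; such a zero is a kind of weighted mean of the u(y) and
    of 0 ([pmean]), and depends continuously on them.  Eliminating the boundary
    values leaves an autonomous system on S with a continuous right-hand side,
    which is continued past T by Peano's theorem ([peano],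
    [bounded_continuation]).  The boundary values of the extension must moreover
    be differentiable in time.  Although the mean is not a differentiable
    function of its arguments, it is differentiable along every differentiable
    curve ([derivable_pmean]). *)

(** * Signed powers *)

(** This is the monotone map a |-> |a|^r a, extended by 0 at a = 0 also when r
    is negative. *)
Definition spow (R : realType) (r a : R) : R := `|a| `^ r * a.

Lemma spow0 (R : realType) (r : R) : spow r 0 = 0.
Proof. by rewrite /spow mulr0. Qed.

Lemma spowN (R : realType) (r a : R) : spow r (- a) = - spow r a.
Proof. by rewrite /spow normrN mulrN. Qed.

Lemma spowM (R : realType) (r a b : R) : spow r (a * b) = spow r a * spow r b.
Proof. by rewrite /spow normrM powRM// mulrACA. Qed.

Lemma ge0_spowE (R : realType) (r a : R) : -1 < r -> 0 <= a ->
  spow r a = a `^ (r + 1).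
Proof.
move=> r1 a0; rewrite /spow ger0_norm// mulrC.
by rewrite -{1}[r](addrK 1) mulr_powRB1//; lra.
Qed.

Lemma norm_spow (R : realType) (r a : R) : -1 < r ->
  `|spow r a| = `|a| `^ (r + 1).
Proof.
move=> r1; rewrite -ge0_spowE// /spow normrM normr_id.
by rewrite (ger0_norm (powR_ge0 _ _)).
Qed.

Lemma mulr_spow (R : realType) (r a : R) : -1 < r ->
  a * spow r a = `|a| `^ (r + 2).
Proof.
move=> r1; rewrite /spow mulrCA -expr2 -real_normK ?num_real//.
rewrite -[X in _ * X](powR_mulrn 2)// -powRD//.
by apply/implyP => /eqP ?; exfalso; lra.
Qed.

Lemma ltr_spow (R : realType) (r a b : R) : -1 < r -> a < b ->
  spow r a < spow r b.
Proof.
move=> r1 ab.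
have pos (x y : R) : 0 <= x -> x < y -> spow r x < spow r y.
  move=> x0 xy; rewrite !ge0_spowE//; last by rewrite ltW// (le_lt_trans x0).
  by apply: gt0_ltr_powR; rewrite ?nnegrE ?(ltW (le_lt_trans x0 xy))//; lra.
have [a0|a0] := leP 0 a; first exact: pos.
have [b0|b0] := leP b 0.
  by rewrite -ltrN2 -!spowN pos ?oppr_ge0// ltrN2.
apply: (@lt_trans _ _ 0).
  by rewrite -oppr_gt0 -spowN -(@spow0 _ r) pos ?oppr_gt0.
by rewrite -(@spow0 _ r) pos.
Qed.

Lemma ler_spow (R : realType) (r a b : R) : -1 < r -> a <= b ->
  spow r a <= spow r b.
Proof.
by move=> r1; rewrite le_eqVlt => /orP[/eqP->//|/(ltr_spow r1)/ltW].
Qed.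

Lemma spow_neq0 (R : realType) (r a : R) : a != 0 -> spow r a != 0.
Proof. by move=> a0; rewrite mulf_neq0// gt_eqF// powR_gt0// normr_gt0. Qed.

Lemma is_derive_spow (R : realType) (r c : R) : c != 0 ->
  is_derive c 1 (spow r) ((r + 1) * `|c| `^ r).
Proof.
have pos (x : R) : 0 < x -> is_derive x 1 (spow r) ((r + 1) * `|x| `^ r).
  move=> x0.
  apply: (@near_eq_is_derive R R R (fun a => a `^ r * a)).
    near=> a; rewrite /spow gtr0_norm//; near: a; exact: lt_nbhsr.
  have h := is_deriveM (is_derive1_powR r x0) (is_derive_id x (1 : R)).
  apply: is_derive_eq h _.
  rewrite /GRing.scale /= mulr1 gtr0_norm// mulrCA mulrC.
  have -> : x `^ r = x * x `^ (r - 1).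
    rewrite -{2}[x](powRr1 (ltW x0)) -powRD ?(gt_eqF x0) ?implybT//.
    by rewrite addrC subrK.
  by ring.
rewrite neq_lt => /orP[c0|/pos//].
have e : spow r = (fun a => - spow r (- a)).
  by apply/funext => a; rewrite spowN opprK.
rewrite e.
have c0' : 0 < - c by rewrite oppr_gt0.
have h := is_derive1_comp (f := spow r) (pos _ c0')
  (is_deriveN (is_derive_id c (1 : R))).
have := is_deriveN h.
rewrite mulrN1 opprK normrN; exact.
Unshelve. all: by end_near. Qed.

Lemma continuous_spow (R : realType) (r : R) : -1 < r -> continuous (spow r).
Proof.
move=> r1 c; have [->|c0] := eqVneq c 0; last first.
  apply/differentiable_continuous/derivable1_diffP.
  by have [] := is_derive_spow r c0.
apply/(@cvgrPdist_lt _ R^o) => eps eps0 /=; near=> a.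
have r0 : 0 < r + 1 by lra.
rewrite spow0 sub0r normrN norm_spow//.
have -> : eps = (eps `^ (r + 1)^-1) `^ (r + 1).
  by rewrite -powRrM mulVf ?gt_eqF// powRr1// ltW.
apply: gt0_ltr_powR; rewrite ?nnegrE ?powR_ge0//.
near: a; apply: (@nbhs0_lt _ R^o); exact: powR_gt0.
Unshelve. all: by end_near. Qed.

(** * Weighted p-means *)
Lemma cvg_sumr (R : realType) (I : finType) (P : pred I) (T : Type)
    (F : set_system T) (FF : Filter F) (f : I -> T -> R) (l : I -> R) :
  (forall i, P i -> f i x @[x --> F] --> l i)%classic ->
  (\sum_(i | P i) f i x @[x --> F] --> \sum_(i | P i) l i)%classic.
Proof. exact: (@cvg_big R I +%R 0 P (@add_continuous R) T F). Qed.

Definition wspow (R : realType) (I : finType) (r : R) (a v : I -> R) (s : R) :=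
  \sum_i a i * spow r (s - v i).

(** For r = p - 2 this is the minimizer of the sum of the a_i |s - v_i|^p: the
    weighted mean for p = 2 and a weighted median in the limit p = 1. *)
Definition pmean (R : realType) (I : finType) (r : R) (a v : I -> R) : R :=
  xget 0 [set s | wspow r a v s = 0]%classic.

Definition weights (R : realType) (I : finType) (a : I -> R) : Prop :=
  (forall i, 0 <= a i) /\ exists i, 0 < a i.

Lemma ltr_wspow (R : realType) (I : finType) (r : R) (a v v' : I -> R)
    (s s' : R) : -1 < r -> weights a -> (forall i, s - v i < s' - v' i) ->
  wspow r a v s < wspow r a v' s'.
Proof.
move=> r1 [a0 [j aj]] h; rewrite /wspow (bigD1 j)//= [ltRHS](bigD1 j)//=.
apply: ltr_leD; first by rewrite ltr_pM2l// ltr_spow.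
by apply: ler_sum => i _; rewrite ler_wpM2l// ltW// ltr_spow.
Qed.

Lemma wspow_const (R : realType) (I : finType) (r : R) (a : I -> R) (s : R) :
  wspow r a (fun=> s) s = 0.
Proof. by rewrite /wspow big1// => i _; rewrite subrr spow0 mulr0. Qed.

Lemma cvg_wspow (R : realType) (I : finType) (r : R) (a : I -> R) (T : Type)
    (F : set_system T) (FF : Filter F) (f : T -> R) (g : T -> I -> R) (s : R)
    (v : I -> R) : -1 < r ->
  (f x @[x --> F] --> s)%classic ->
  (forall i, g x i @[x --> F] --> v i)%classic ->
  (wspow r a (g x) (f x) @[x --> F] --> wspow r a v s)%classic.
Proof.
move=> r1 fs gv; apply: cvg_sumr => i _; apply: cvgM; first exact: cvg_cst.
apply: (@continuous_cvg _ _ _ F FF (fun x => f x - g x i) (spow r)).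
  exact: continuous_spow.
exact: cvgB.
Qed.

Lemma pmeanP (R : realType) (I : finType) (r : R) (a v : I -> R) :
  -1 < r -> weights a -> wspow r a v (pmean r a v) = 0.
Proof.
move=> r1 wa.
suff [s hs] : exists s, wspow r a v s = 0.
  by apply: (@xgetPex _ 0 [set s | wspow r a v s = 0]%classic); exists s.
pose K := 1 + \sum_i `|v i|.
have vK i : `|v i| < K.
  by rewrite /K (bigD1 i)//= addrCA ltrDl ltr_wpDr// sumr_ge0.
have lo : wspow r a v (- K) < 0.
  rewrite -(wspow_const r a 0); apply: ltr_wspow => // i.
  by have := vK i; rewrite ltr_norml => /andP[? ?]; lra.
have hi : 0 < wspow r a v K.
  rewrite -(wspow_const r a 0); apply: ltr_wspow => // i.
  by have := vK i; rewrite ltr_norml => /andP[? ?]; lra.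
have KK : - K <= K by rewrite -subr_ge0 opprK addr_ge0 ?addr_ge0 ?sumr_ge0.
have [||s _ hs] := @IVT R (wspow r a v) (- K) K 0 KK.
- apply: continuous_subspaceT => s.
  apply: (@cvg_wspow _ _ _ _ _ _ _ id (fun=> v)) => //.
  by move=> i; exact: cvg_cst.
- by rewrite ge_min le_max (ltW lo) (ltW hi) orbT.
by exists s.
Qed.

Lemma pmean_lt (R : realType) (I : finType) (r : R) (a v : I -> R) (s : R) :
  -1 < r -> weights a -> 0 < wspow r a v s -> pmean r a v < s.
Proof.
move=> r1 wa; apply: contraPlt => sv; apply/negP.
rewrite -leNgt -(pmeanP v r1 wa).
move: sv; rewrite le_eqVlt => /orP[/eqP<-//|sv].
by apply/ltW/ltr_wspow => // i; rewrite ltrD2r.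
Qed.

Lemma pmean_gt (R : realType) (I : finType) (r : R) (a v : I -> R) (s : R) :
  -1 < r -> weights a -> wspow r a v s < 0 -> s < pmean r a v.
Proof.
move=> r1 wa; apply: contraPlt => sv; apply/negP.
rewrite -leNgt -(pmeanP v r1 wa).
move: sv; rewrite le_eqVlt => /orP[/eqP<-//|sv].
by apply/ltW/ltr_wspow => // i; rewrite ltrD2r.
Qed.

Lemma pmean_eq (R : realType) (I : finType) (r : R) (a v : I -> R) (s : R) :
  -1 < r -> weights a -> wspow r a v s = 0 -> pmean r a v = s.
Proof.
move=> r1 wa e; apply/eqP; rewrite eq_le !leNgt.
apply/andP; split; apply/negP => h.
  have : wspow r a v s < wspow r a v (pmean r a v).
    by apply: ltr_wspow => // i; rewrite ltrD2r.
  by rewrite e pmeanP// ltxx.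
have : wspow r a v (pmean r a v) < wspow r a v s.
  by apply: ltr_wspow => // i; rewrite ltrD2r.
by rewrite e pmeanP// ltxx.
Qed.

Lemma pmean_bound (R : realType) (I : finType) (r K : R) (a v : I -> R) :
  -1 < r -> weights a -> (forall i, `|v i| <= K) -> `|pmean r a v| <= K.
Proof.
move=> r1 wa vK; apply/ler_addgt0Pr => eps eps0.
rewrite ler_norml; apply/andP; split; apply: ltW.
  apply: pmean_gt => //; rewrite -(wspow_const r a 0); apply: ltr_wspow => // i.
  by have := vK i; rewrite ler_norml => /andP[? ?]; lra.
apply: pmean_lt => //; rewrite -(wspow_const r a 0); apply: ltr_wspow => // i.
by have := vK i; rewrite ler_norml => /andP[? ?]; lra.
Qed.

(** The equation of the mean is invariant under translations and, since signed
    powers are multiplicative, under scalings of either sign.  Hence a difference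
    quotient of means is the mean of the corresponding quotients of the data,
    which is what makes [derivable_pmean] accessible to [cvg_pmean]. *)
Lemma pmean_affine (R : realType) (I : finType) (r : R) (a v : I -> R)
    (s h : R) : -1 < r -> weights a -> h != 0 ->
  pmean r a (fun i => h^-1 * (v i - s)) = h^-1 * (pmean r a v - s).
Proof.
move=> r1 wa h0; apply: pmean_eq => //.
rewrite -(mulr0 (spow r h^-1)) -(pmeanP v r1 wa) /wspow mulr_sumr.
apply: eq_bigr => i _; rewrite [RHS]mulrCA -spowM.
by congr (_ * spow r _); ring.
Qed.

(** A mean is located by the signs of its equation, and these do not change when
    the equation is multiplied by a positive factor N.  The factor allows the
    limit equation to have another exponent and other weights. *)
Lemma cvg_pmean (R : realType) (I : finType) (r r' : R) (a b d : I -> R)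
    (T : Type) (F : set_system T) (FF : Filter F) (N : T -> R)
    (g : T -> I -> R) : -1 < r -> weights a -> -1 < r' -> weights b ->
  (\forall x \near F, 0 < N x) ->
  (forall s, N x * wspow r a (g x) s @[x --> F] --> wspow r' b d s)%classic ->
  (pmean r a (g x) @[x --> F] --> pmean r' b d)%classic.
Proof.
move=> r1 wa r'1 wb N0 h; apply/(@cvgrPdist_lt _ R^o) => eps eps0 /=.
set rho := pmean r' b d.
have hi : 0 < wspow r' b d (rho + eps).
  rewrite -(pmeanP d r'1 wb); apply: ltr_wspow => // i.
  by rewrite ltrD2r ltrDl.
have lo : wspow r' b d (rho - eps) < 0.
  rewrite -(pmeanP d r'1 wb); apply: ltr_wspow => // i.
  by rewrite ltrD2r gtrBl.
have h1 := @cvgr_gt _ _ _ _ _ _ (h (rho + eps)) _ hi.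
have h2 := @cvgr_lt _ _ _ _ _ _ (h (rho - eps)) _ lo.
near=> x; have Nx : 0 < N x by near: x.
have gt0 : 0 < N x * wspow r a (g x) (rho + eps) by near: x; exact: h1.
have lt0 : N x * wspow r a (g x) (rho - eps) < 0 by near: x; exact: h2.
have l1 : pmean r a (g x) < rho + eps.
  by apply: pmean_lt => //; rewrite -(pmulr_rgt0 _ Nx).
have l2 : rho - eps < pmean r a (g x).
  by apply: pmean_gt => //; rewrite -(pmulr_rlt0 _ Nx).
by rewrite ltr_norml; apply/andP; split; lra.
Unshelve. all: by end_near. Qed.

Lemma derivable_diffquot (R : realType) (f : R -> R) (t : R) :
  derivable f t 1 ->
  (h^-1 * (f (h + t) - f t) @[h --> 0^'] --> f^`() t)%classic.
Proof.
move=> df; rewrite derive1E; apply: cvg_trans df; apply: near_eq_cvg.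
by near=> h; rewrite /GRing.scale /= mulr1.
Unshelve. all: by end_near. Qed.

(** The difference quotient of the mean at time t is the mean of the quotients
    g_i(h) = (c_i(t+h) - s) / h, where s is the mean at time t.  For the indices
    with c_i(t) = s these converge to the derivatives d_i; for the others they
    are unbounded, but then psi(rho - g_i(h)) differs from its value at rho = 0
    and frozen c_i by a quantity of order |h|^(-r), and the frozen values cancel
    in the sum because s solves the equation at time t.  As -r > 0, the limit
    equation involves only the indices with c_i(t) = s, if there are any of
    positive weight.  Otherwise, after multiplication by |h|^r, it is the
    linear equation, with r = 0, given by the implicit function theorem.  In both
    cases the limit is again a mean, and [cvg_pmean] applies. *)
Lemma derivable_pmean (R : realType) (I : finType) (r : R) (a : I -> R)
    (c : R -> I -> R) (t : R) : -1 < r < 0 -> weights a ->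
  (forall i, derivable (c^~ i) t 1) ->
  derivable (fun x => pmean r a (c x)) t 1.
Proof.
move=> /andP[r1 r0] wa dc; have [a0 [j aj]] := wa.
set s := pmean r a (c t).
pose d i : R := derive1 (c^~ i) t.
pose g h i := h^-1 * (c (h + t) i - s).
have quot : exists l : R,
    (pmean r a (g h) @[h --> 0^'] --> l)%classic; last first.
  move: quot => [l lP]; apply: (cvgP (l : R)); apply: cvg_trans lP.
  apply: near_eq_cvg; near=> h.
  rewrite /= /GRing.scale /= mulr1 pmean_affine//.
  near: h; exact: nbhs_dnbhs_neq.
(* The k i are the frozen values; they may be subtracted as their weighted sum
   vanishes. *)
pose k i := spow r (s - c t i).
have ak : \sum_i a i * k i = 0 by exact: pmeanP.
pose G rho h i := spow r (rho - g h i) - k i * spow r h^-1.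
have GE rho h : wspow r a (g h) rho = \sum_i a i * G rho h i.
  rewrite /G; under [RHS]eq_bigr do rewrite mulrBr (mulrA _ (k _)).
  by rewrite sumrB -mulr_suml ak mul0r subr0.
have gcvg i : c t i = s -> (g h i @[h --> 0^'] --> d i)%classic.
  by move=> e; rewrite /g -e; exact: derivable_diffquot (dc i).
have Gcvg0 rho i : c t i = s ->
    (G rho h i @[h --> 0^'] --> spow r (rho - d i))%classic.
  move=> e; rewrite /G /k e subrr spow0; under eq_cvg do rewrite mul0r subr0.
  apply: (@continuous_cvg _ _ _ _ _ (fun h => rho - g h i) (spow r)).
    exact: continuous_spow.
  apply: cvgB; [exact: cvg_cst|exact: gcvg].
pose D i := (r + 1) * `|s - c t i| `^ r.
have Gcvg rho i : c t i != s ->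
    (`|h| `^ r * G rho h i @[h --> 0^'] --> D i * (rho - d i))%classic.
  move=> e; pose f x := s + (x - t) * rho - c x i.
  have fd : is_derive t 1 f (rho - d i).
    have ci : is_derive t 1 (c^~ i) (d i).
      by split; [exact: dc|rewrite -derive1E].
    have li : is_derive t 1 (fun x : R => s - t * rho + rho * x) rho.
      have := is_deriveD (is_derive_cst (s - t * rho) t 1)
        (is_deriveZ rho (is_derive_id t (1 : R))).
      by rewrite add0r /GRing.scale /= mulr1.
    have -> : f = (fun x => s - t * rho + rho * x) - c^~ i.
      by apply/funext => x; rewrite /f !fctE; ring.
    exact: is_deriveB.
  have ft : f t = s - c t i by rewrite /f subrr mul0r addr0.
  have sd : is_derive (f t) 1 (spow r) (D i).
    by rewrite ft; apply: is_derive_spow; rewrite subr_eq0 eq_sym.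
  have [h1 h2] := is_derive1_comp sd fd.
  have := derivable_diffquot h1; rewrite derive1E h2.
  apply: cvg_trans; apply: near_eq_cvg; near=> h.
  have h0 : h != 0 by near: h; exact: nbhs_dnbhs_neq.
  rewrite /= ft -/(k i) /G.
  have -> : rho - g h i = h^-1 * f (h + t).
    by rewrite /g /f addrK; field.
  have N : `|h| `^ r * spow r h^-1 = h^-1.
    by rewrite /spow mulrA -powRM// -normrM mulfV// normr1 powR1 mul1r.
  by rewrite spowM (mulrC _ (spow r (f _))) -mulrBl mulrCA N mulrC.
have N0 : (\forall h \near (0 : R)^', 0 < `|h| `^ r)%classic.
  near=> h; rewrite powR_gt0// normr_gt0; near: h; exact: nbhs_dnbhs_neq.
(* First case: some index of positive weight has c_i(t) = s; only such indices
   survive in the limit. *)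
have [[i0 /andP[/eqP ci0 ai0]]|noK] :=
    pselect (exists i, (c t i == s) && (0 < a i)).
  pose b i := if c t i == s then a i else 0.
  have wb : weights b.
    split; last by exists i0; rewrite /b ci0 eqxx.
    by move=> i; rewrite /b; case: ifP.
  exists (pmean r b d).
  apply: (@cvg_pmean _ _ _ _ _ _ _ _ _ _ (fun=> 1)) => //.
    exact: nearW.
  move=> rho; under eq_cvg do rewrite mul1r GE.
  apply: cvg_sumr => i _; rewrite /b; case: eqP => e.
    by apply: cvgM; [exact: cvg_cst|exact: Gcvg0].
  have lim0 : (`|h| `^ (- r) @[h --> (0:R)^'] --> (0 : R))%classic.
    have c0 : (`|spow (- r - 1) h| @[h --> (0 : R)] --> (0 : R))%classic.
      rewrite -{2}(normr0 R) -{2}(spow0 (- r - 1)).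
      by apply: cvg_norm; apply: continuous_spow; lra.
    have c1 : (`|spow (- r - 1) h| @[h --> (0 : R)^'] --> (0 : R))%classic.
      exact: cvg_within_filter c0.
    apply: cvg_trans c1; apply: near_eq_cvg.
    by apply: nearW => h; rewrite norm_spow ?subrK//; lra.
  have lim1 : (a i * (`|h| `^ (- r) * (`|h| `^ r * G rho h i))
      @[h --> 0^'] --> a i * (0 * (D i * (rho - d i))))%classic.
    apply: cvgM; first exact: cvg_cst.
    by apply: cvgM => //; apply: Gcvg; apply/eqP.
  move: lim1; rewrite !mul0r mulr0.
  apply: cvg_trans; apply: near_eq_cvg; near=> h.
  congr (_ * _).
  by rewrite mulrA powRN mulVf ?mul1r// gt_eqF//; near: h.
(* Second case: psi is differentiable at all relevant s - c_i(t), and the limit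
   equation is linear with weights a_i psi'(s - c_i(t)). *)
pose b i := a i * D i.
have nK i : 0 < a i -> c t i != s.
  by move=> ai; apply/negP => e; apply: noK; exists i; rewrite e.
have wb : weights b.
  split=> [i|]; first by rewrite /b mulr_ge0// mulr_ge0 ?powR_ge0//; lra.
  exists j; rewrite /b mulr_gt0// mulr_gt0//; first lra.
  by rewrite powR_gt0// normr_gt0 subr_eq0 eq_sym nK.
exists (pmean 0 b d).
apply: (@cvg_pmean _ _ _ _ _ _ _ _ _ _ (fun h => `|h| `^ r)) => //.
move=> rho; under eq_cvg do rewrite GE mulr_sumr.
apply: cvg_sumr => i _; rewrite /b /spow powRr0 mul1r -mulrA.
have -> : (fun h => `|h| `^ r * (a i * G rho h i)) =
    (fun h => a i * (`|h| `^ r * G rho h i)).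
  by apply/funext => h; rewrite mulrCA.
have [/nK ci|ai] := ltP 0 (a i).
  by apply: cvgM; [exact: cvg_cst|exact: Gcvg].
have e : a i = 0 by apply/eqP; rewrite eq_le ai a0.
have -> : (fun h => a i * (`|h| `^ r * G rho h i)) = cst 0.
  by apply/funext => h; rewrite e mul0r.
by rewrite e mul0r; exact: cvg_cst.
Unshelve. all: by end_near. Qed.

(** * Continuous systems of ordinary differential equations *)
Definition coordwise_continuous (R : realType) (I : finType)
    (f : (I -> R) -> I -> R) : Prop :=
  forall v eps, 0 < eps -> exists2 delta, 0 < delta &
    forall v', (forall i, `|v' i - v i| <= delta) ->
      forall i, `|f v' i - f v i| <= eps.

Fixpoint euler (R : realType) (I : Type) (f : (I -> R) -> I -> R)
    (v0 : I -> R) (h : R) (k : nat) : I -> R :=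
  if k is k'.+1 then fun i => euler f v0 h k' i + h * f (euler f v0 h k') i
  else v0.

Lemma euler_slope (R : realType) (I : Type) (f : (I -> R) -> I -> R)
    (v0 : I -> R) (h : R) (i : I) (A eps : R) (j k : nat) : 0 <= h ->
  (j <= k)%N ->
  (forall m, (j <= m < k)%N -> `|f (euler f v0 h m) i - A| <= eps) ->
  `|euler f v0 h k i - euler f v0 h j i - (k - j)%:R * h * A|
    <= (k - j)%:R * h * eps.
Proof.
move=> h0 /subnKC <-; rewrite addKn; elim: (k - j)%N => [|n IH] H.
  by rewrite addn0 subrr !mul0r subr0 normr0.
have {}IH : `|euler f v0 h (j + n) i - euler f v0 h j i - n%:R * h * A|
    <= n%:R * h * eps.
  by apply: IH => m /andP[jm mn]; apply: H; rewrite jm addnS ltnS ltnW.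
have {}H : `|f (euler f v0 h (j + n)) i - A| <= eps.
  by apply: H; rewrite leq_addr addnS ltnSn.
rewrite addnS /= -natr1 !mulrDl !mul1r.
have -> : euler f v0 h (j + n) i + h * f (euler f v0 h (j + n)) i
   - euler f v0 h j i - (n%:R * h * A + h * A) =
   (euler f v0 h (j + n) i - euler f v0 h j i - n%:R * h * A)
   + h * (f (euler f v0 h (j + n)) i - A) by ring.
apply: le_trans (ler_normD _ _) _; apply: lerD => //.
by rewrite normrM (ger0_norm h0) ler_wpM2l.
Qed.

Lemma ultra_fmap (T U : Type) (f : T -> U) (F : set_system T) :
  UltraFilter F -> UltraFilter (f @ F)%classic.
Proof.
move=> FU; split=> [|G GF FG]; first exact: fmap_proper_filter.
apply/seteqP; split=> A; last exact: FG.
move=> GA; have [//|FA] := in_ultra_setVsetC (f @^-1` A)%classic FU.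
have GA' : G (~` A)%classic by apply: FG.
by case: (@filter_not_empty _ G _); rewrite -(setICr A); exact: filterI.
Qed.

(** Limits along an ultrafilter exist for all bounded families at once; they
    replace the extraction of subsequences in the proof of Peano's theorem. *)
Lemma ultra_cvg_bounded (R : realType) (T : Type) (U : set_system T)
    (x : T -> R) (c d : R) : UltraFilter U ->
  (forall n, `|x n - c| <= d) -> exists l : R, (x n @[n --> U] --> l)%classic.
Proof.
move=> UU xd; have /= := @segment_compact R (c - d) (c + d).
rewrite compact_ultra /= => /(_ (x n @[n --> U])%classic (ultra_fmap x UU)).
case=> [|l [_ ?]]; last by exists l.
apply: (@filterE _ U) => n; have := xd n.
by rewrite /= in_itv/= ler_norml => /andP[? ?]; apply/andP; split; lra.
Qed.

Lemma grid_step (R : realType) (s t N : R) : 0 <= s -> s <= t -> 0 < N ->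
  (Num.truncn (s * N) <= Num.truncn (t * N))%N /\
  `|(Num.truncn (t * N) - Num.truncn (s * N))%:R * N^-1 - (t - s)| <= N^-1.
Proof.
move=> s0 st N0.
have h : s * N <= t * N by rewrite ler_wpM2r// ltW.
have le := le_truncn h; split => //.
have sN : 0 <= s * N by rewrite mulr_ge0// ltW.
have /andP[h1 h2] := truncn_itv sN.
have /andP[h3 h4] := truncn_itv (le_trans sN h).
rewrite natrB//.
rewrite [X in `|X|](_ : _ = N^-1 * (((Num.truncn (t * N))%:R - t * N)
    - ((Num.truncn (s * N))%:R - s * N))); last by field; rewrite gt_eqF.
rewrite normrM gtr0_norm ?invr_gt0// -[leRHS]mulr1 ler_pM2l ?invr_gt0//.
rewrite -natr1 in h2; rewrite -natr1 in h4.
by rewrite ler_norml; apply/andP; split; lra.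
Qed.

(** Let e_n be the Euler polygon of step 1/(n+1), read as a step function, and
    let v be its pointwise limit along a nonprincipal ultrafilter.  Local uniform
    convergence is not needed: if s is close to t, all Euler iterates at times
    between s and t are close to e_n(t), because f is bounded, and e_n(t) is
    close to v(t) for most n.  So all slopes used by the scheme between s and t
    are close to f (v t), hence so is the slope of e_n from s to t, and this
    passes to the limit. *)
Lemma peano (R : realType) (I : finType) (f : (I -> R) -> I -> R)
    (v0 : I -> R) (M : R) : coordwise_continuous f -> 0 <= M ->
  (forall v i, `|f v i| <= M) ->
  exists v : R -> I -> R, [/\ forall i, v 0 i = v0 i,
    forall t i, 0 <= t -> `|v t i - v0 i| <= M * t &
    forall t i eps, 0 <= t -> 0 < eps -> exists2 delta, 0 < delta &
      forall s, 0 <= s -> `|s - t| <= delta ->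
        `|v s i - v t i - (s - t) * f (v t) i| <= eps * `|s - t|].
Proof.
move=> fc M0 fM.
have [U [UU sU]] := ultraFilterLemma (@eventually_filter).
pose N n : R := n.+1%:R.
have N0 n : 0 < N n by rewrite ltr0n.
have Ni0 n : 0 <= (N n)^-1 by rewrite invr_ge0 ltW.
pose e n := euler f v0 (N n)^-1.
pose k n t := Num.truncn (t * N n).
have eM n i j m : (j <= m)%N ->
    `|e n m i - e n j i| <= (m - j)%:R * (N n)^-1 * M.
  move=> jm.
  have := @euler_slope R I f v0 (N n)^-1 i 0 M j m (Ni0 n) jm.
  by rewrite mulr0 subr0; apply => l _; rewrite subr0.
have stM n t i : 0 <= t -> `|e n (k n t) i - v0 i| <= M * t.
  move=> t0; have := eM n i 0%N (k n t) (leq0n _); rewrite subn0.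
  move=> /le_trans; apply; rewrite mulrC ler_wpM2l//.
  rewrite ler_pdivrMr//.
  by have /andP[] := truncn_itv (mulr_ge0 t0 (ltW (N0 n))).
have ex t i : exists l : R,
    0 <= t -> (e n (k n t) i @[n --> U] --> l)%classic.
  have [t0|t0] := leP 0 t; last by exists 0 => t0'; exfalso; lra.
  have [l lP] := ultra_cvg_bounded UU (fun n => stM n t i t0).
  by exists l.
have {ex}[v vP] : exists v : R -> I -> R, forall t i, 0 <= t ->
    (e n (k n t) i @[n --> U] --> v t i)%classic.
  have h t : exists vt : I -> R, forall i, 0 <= t ->
    (e n (k n t) i @[n --> U] --> vt i)%classic.
    by have [g gP] := choice (ex t); exists g.
  by have [g gP] := choice h; exists g.
have Nsmall d : 0 < d -> (\forall n \near U, (N n)^-1 <= d)%classic.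
  move=> d0; apply: sU; near=> n; apply: ltW; near: n.
  exact: near_infty_natSinv_lt (PosNum d0).
exists v; split.
- move=> i; have h := vP 0 i (lexx _).
  apply: (cvg_unique (@Rhausdorff R) h).
  have -> : (fun n => e n (k n 0) i) = cst (v0 i).
    by apply/funext => n; rewrite /k mul0r truncn0.
  exact: cvg_cst.
- move=> t i t0; have h := vP t i t0.
  have c : (`|e n (k n t) i - v0 i| @[n --> U] --> `|v t i - v0 i|)%classic.
    by apply: cvg_norm; apply: cvgB => //; exact: cvg_cst.
  apply: (cvgr_to_le c); apply: nearW => n; exact: stM.
move=> t i eps t0 eps0; set A := f (v t) i.
have [d d0 dP] := fc (v t) eps eps0.
(* One third of d is spent on e_n(t) - v(t), the rest on the variation of e_n
   over a time delta + 1/(n+1) <= 2 delta. *)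
pose delta := d / (3 * (M + 1)).
have M1 : 0 < 3 * (M + 1) by lra.
have delta0 : 0 < delta by rewrite divr_gt0.
have deltaM : delta * M <= d / 3.
  have : delta * (3 * (M + 1)) = d by rewrite /delta divfK// gt_eqF.
  by rewrite mulrCA mulrDr mulr1; lra.
(* The two one-sided estimates are the cases where t is the right and the left
   end of [s1, s2]. *)
have key s1 s2 : 0 <= s1 -> s1 <= s2 -> t = s1 \/ t = s2 -> s2 - s1 <= delta ->
    `|v s2 i - v s1 i - (s2 - s1) * A| <= (s2 - s1) * eps.
  move=> s10 s12 ts s12d.
  have s20 := le_trans s10 s12.
  pose L n := (k n s2 - k n s1)%:R * (N n)^-1.
  have Lc : (L n @[n --> U] --> s2 - s1)%classic.
    apply/(@cvgrPdist_le _ R^o) => r r0; move: (Nsmall r r0).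
    apply: filterS => n /= /(le_trans _); apply; rewrite distrC.
    by have [_] := grid_step s10 s12 (N0 n).
  have c1 : (`|e n (k n s2) i - e n (k n s1) i - L n * A| @[n --> U] -->
      `|v s2 i - v s1 i - (s2 - s1) * A|)%classic.
    apply: cvg_norm; apply: cvgB; first by apply: cvgB; exact: vP.
    by apply: cvgM => //; exact: cvg_cst.
  have c2 : (L n * eps @[n --> U] --> (s2 - s1) * eps)%classic.
    by apply: cvgM => //; exact: cvg_cst.
  apply: (ler_cvg_to c1 c2).
  have near_t : (\forall n \near U, forall y,
      `|e n (k n t) y - v t y| <= d / 3)%classic.
    apply: filter_forall => y.
    by apply: (@cvgr_distC_le _ R^o) (vP t y t0) _ _; rewrite divr_gt0.
  move: (Nsmall delta delta0) near_t; apply: filterS2 => n /= Nd et.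
  have [kk] := grid_step s10 s12 (N0 n); rewrite -/(L n) => Ls.
  have LM : L n * M <= d / 3 * 2.
    have : L n <= delta * 2.
      move: (L n) (N n)^-1 Ls Nd => l o; rewrite ler_norml => /andP[? ?] ?; lra.
    by move=> /(ler_wpM2r M0); lra.
  apply: euler_slope => // m /andP[m1 m2]; apply: dP => y.
  have em : `|e n m y - e n (k n t) y| <= L n * M.
    case: ts => ->.
      apply: le_trans (eM _ _ _ _ m1) _; rewrite ler_wpM2r// ler_wpM2r//.
      by rewrite ler_nat leq_sub2r// ltnW.
    rewrite distrC; apply: le_trans (eM _ _ _ _ (ltnW m2)) _.
    by rewrite ler_wpM2r// ler_wpM2r// ler_nat leq_sub2l.
  have := ler_normD (e n m y - e n (k n t) y) (e n (k n t) y - v t y).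
  rewrite addrA subrK => /le_trans; apply.
  by have := et y; lra.
exists delta => // s s0; have [st|ts] := leP s t.
  rewrite ler0_norm ?subr_le0// opprB => h.
  have := key s t s0 st (or_intror erefl) h.
  by rewrite -normrN mulrC; congr (`|_| <= _); ring.
rewrite gtr0_norm ?subr_gt0// [eps * _]mulrC => h.
by apply: key => //; [exact: ltW|left].
Unshelve. all: by end_near. Qed.

Definition coordwise_bounded (R : realType) (I : finType)
    (f : (I -> R) -> I -> R) : Prop :=
  forall K, exists M, forall v, (forall i, `|v i| <= K) ->
    forall i, `|f v i| <= M.

Lemma is_derive_eps (R : realType) (f : R -> R) (t A : R) :
  (forall eps, 0 < eps -> exists2 delta, 0 < delta & forall s,
    `|s - t| < delta -> `|f s - f t - (s - t) * A| <= eps * `|s - t|) ->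
  is_derive t 1 f A.
Proof.
move=> H.
suff L : (h^-1 *: ((f \o shift t) (h *: 1) - f t) @[h --> 0^'] --> A)%classic.
  apply: DeriveDef; first exact: cvgP L.
  exact: (cvg_lim (@Rhausdorff R) L).
apply/(@cvgrPdist_le _ R^o) => eps eps0.
have [d d0 dP] := H eps eps0.
near=> h.
have h0 : h != 0 by near: h; exact: nbhs_dnbhs_neq.
have hd : `|h| < d by near: h; exact: dnbhs0_lt.
have := dP (h + t); rewrite addrK => /(_ hd) b.
rewrite /GRing.scale /= mulr1.
have -> : A - h^-1 * (f (h + t) - f t) = - (h^-1 * (f (h + t) - f t - h * A)).
  by field.
by rewrite normrN normrM normfV mulrC ler_pdivrMr// normr_gt0.
Unshelve. all: by end_near. Qed.

Definition clamp (R : realType) (K a : R) : R := Num.max (- K) (Num.min K a).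

Lemma clamp_id (R : realType) (K a : R) : `|a| <= K -> clamp K a = a.
Proof.
by rewrite ler_norml => /andP[h1 h2]; rewrite /clamp min_r// max_r.
Qed.

Lemma clamp_bound (R : realType) (K a : R) : 0 <= K -> `|clamp K a| <= K.
Proof.
by move=> K0; rewrite ler_norml le_max lexx ge_max ge_min lexx andbT /=; lra.
Qed.

Lemma clamp_lip (R : realType) (K a b : R) :
  `|clamp K a - clamp K b| <= `|a - b|.
Proof.
wlog ab : a b / b <= a.
  by move=> H; have [/H//|/ltW/H] := leP b a; rewrite distrC (distrC b).
rewrite [leRHS]ger0_norm ?subr_ge0// ler_norml /clamp.
by case: (leP K a) => ?; case: (leP K b) => ?; case: (leP (- K) K) => ?;
  case: (leP (- K) a) => ?; case: (leP (- K) b) => ?; apply/andP; split; lra.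
Qed.

Lemma mean_value_estimate (R : realType) (f df : R -> R) (s t A eps : R) :
  s < t -> (forall x, s <= x <= t -> is_derive x 1 f (df x)) ->
  (forall x, s < x < t -> `|df x - A| <= eps) ->
  `|f t - f s - (t - s) * A| <= eps * (t - s).
Proof.
move=> st fd dfA.
have [||c] := @MVT R f df s t st.
- by move=> x; rewrite in_itv /= => /andP[? ?]; apply: fd; rewrite !ltW.
- apply: derivable_within_continuous => x; rewrite in_itv /= => xst.
  by have [] := fd x xst.
rewrite in_itv /= => cst ->.
rewrite (mulrC _ A) -mulrBl normrM [`|t - s|]gtr0_norm ?subr_gt0//.
by rewrite ler_pM2r ?subr_gt0// dfA.
Qed.

(** The Lipschitz bound says that f(s) - M (T - s) <= f(t) + M (T - t) for all s
    and t, so the supremum of the left-hand sides separates both families. *)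
Lemma lipschitz_left_limit (R : realType) (f : R -> R) (T M : R) : 0 < T ->
  (forall s t, 0 < s -> s < t -> t < T -> `|f t - f s| <= M * (t - s)) ->
  exists l, forall t, 0 < t -> t < T -> `|f t - l| <= M * (T - t).
Proof.
move=> T0 fM.
pose A : set R := [set f s - M * (T - s) | s in [set s | 0 < s < T]]%classic.
have half : 0 < T / 2 < T by apply/andP; split; lra.
have Aub t : 0 < t -> t < T -> ubound A (f t + M * (T - t)).
  move=> t0 tT _ [s /= /andP[s0 sT] <-].
  have M0 : 0 <= M.
    have h := fM (T / 2) (T / 2 + T / 4).
    have : 0 <= M * (T / 2 + T / 4 - T / 2).
      by apply: le_trans (normr_ge0 _) (h _ _ _); lra.
    by rewrite pmulr_lge0//; lra.
  have b : `|f t - f s| <= M * `|t - s|.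
    have [st|ts|->] := ltgtP s t.
    - by rewrite [`|t - s|]gtr0_norm ?subr_gt0//; exact: fM.
    - rewrite distrC (distrC t) [`|s - t|]gtr0_norm ?subr_gt0//; exact: fM.
    - by rewrite !subrr normr0 mulr0.
  have c : M * `|t - s| <= M * (T - t) + M * (T - s).
    rewrite -mulrDr ler_wpM2l// ler_norml; apply/andP; split; lra.
  by move: b; rewrite ler_norml => /andP[? ?]; lra.
have Ane : (A !=set0)%classic by exists (f (T / 2) - M * (T - T / 2)), (T / 2).
exists (sup A) => t t0 tT.
have h1 : sup A <= f t + M * (T - t) by apply: ge_sup => //; exact: Aub.
have h2 : f t - M * (T - t) <= sup A.
  apply: ub_le_sup; last by exists t => //=; rewrite t0.
  by exists (f t + M * (T - t)); exact: Aub.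
by rewrite ler_norml; apply/andP; split; lra.
Qed.

(** A function with a left limit l at T, and whose derivative has the left limit
    A there, has the left derivative A once it is given the value l at T. *)
Lemma left_limit_slope (R : realType) (f df : R -> R) (T M A l : R) :
  0 <= M -> 0 < T -> (forall s, 0 < s -> s < T -> is_derive s 1 f (df s)) ->
  (forall s, 0 < s -> s < T -> `|f s - l| <= M * (T - s)) ->
  (forall eps, 0 < eps -> exists2 d, 0 < d &
    forall s, 0 < s -> s < T -> T - s < d -> `|df s - A| <= eps) ->
  forall eps, 0 < eps -> exists2 d, 0 < d &
    forall s, s < T -> T - s < d -> `|f s - l - (s - T) * A| <= eps * (T - s).
Proof.
move=> M0 T0 fd fl dfA eps eps0; have [d d0 dP] := dfA eps eps0.
exists (Num.min T d); first by rewrite lt_min T0.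
move=> s sT; rewrite lt_min => /andP[sT' sd].
have s0 : 0 < s by rewrite -subr_gt0; lra.
apply/ler_addgt0Pr => eta eta0.
(* Estimate up to a time s' < T at which the two remainders caused by
   replacing T by s' add up to at most eta. *)
pose Q := M + `|A| + 1; have Q0 : 0 < Q by rewrite ltr_wpDl// addr_ge0.
pose s' := Num.max ((s + T) / 2) (T - eta / Q).
have eQ : 0 < eta / Q by rewrite divr_gt0.
have ss' : s < s' by rewrite lt_max; apply/orP; left; lra.
have s'T : s' < T by rewrite gt_max; apply/andP; split; lra.
have main : `|f s' - f s - (s' - s) * A| <= eps * (s' - s).
  apply: (mean_value_estimate ss' (df := df)) => x /andP[sx xs'].
    by apply: fd; [exact: lt_le_trans sx|exact: le_lt_trans s'T].
  apply: dP; [exact: lt_trans sx|exact: lt_trans s'T|].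
  by apply: le_lt_trans sd; rewrite lerB// ltW.
have rest := fl s' (lt_trans s0 ss') s'T.
have h3 : (T - s') * Q <= eta.
  by rewrite -ler_pdivlMr// lerBlDr -lerBlDl le_max lexx orbT.
have -> : f s - l - (s - T) * A = - (f s' - f s - (s' - s) * A)
   + ((f s' - l) + (T - s') * A) by ring.
apply: le_trans (ler_normD _ _) _; rewrite normrN.
have := ler_normD (f s' - l) ((T - s') * A).
rewrite [`|_ * A|]normrM [`|T - s'|]gtr0_norm ?subr_gt0// => h4.
have h5 : eps * (s' - s) <= eps * (T - s) by rewrite ler_pM2l// lerB// ltW.
move: h3 main rest h4 h5; rewrite /Q !mulrDr mulr1 (mulrC _ M).
lra.
Qed.

(** A bounded solution has bounded slopes, hence left limits at T, from which it
    is restarted by [peano] after clamping the arguments of f to make it globally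
    bounded; clamping is invisible for a short time.  At T itself the slope from
    the left agrees with f by [left_limit_slope]. *)
Lemma bounded_continuation (R : realType) (I : finType)
    (f : (I -> R) -> I -> R) (u : I -> R -> R) (T K : R) :
  coordwise_continuous f -> coordwise_bounded f -> 0 < T ->
  (forall t, 0 < t -> t < T -> forall i,
    is_derive t 1 (u i) (f (u^~ t) i)) ->
  (forall t, 0 < t -> t < T -> forall i, `|u i t| <= K) ->
  exists2 T', T < T' & exists g : I -> R -> R,
    (forall t, t < T -> forall i, g i t = u i t) /\
    (forall t, 0 < t -> t < T' -> forall i,
      is_derive t 1 (g i) (f (g^~ t) i)).
Proof.
move=> fc fb T0 ud uK.
pose K1 := `|K| + 1.
have K10 : 0 <= K1 by rewrite addr_ge0.
have KK1 : K + 1 <= K1 by rewrite lerD2r ler_norm.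
have [M [M0 fM]] : exists M, 0 <= M /\
    forall v, (forall i, `|v i| <= K1) -> forall i, `|f v i| <= M.
  have [M fM] := fb K1; exists `|M|; split=> // v vK i.
  by apply: le_trans (fM v vK i) (ler_norm _).
have uK1 t : 0 < t -> t < T -> forall i, `|u i t| <= K1.
  by move=> t0 tT i; have := uK t t0 tT i; lra.
have ex i : exists li, forall t, 0 < t -> t < T ->
    `|u i t - li| <= M * (T - t).
  apply: lipschitz_left_limit => // s t s0 st tT.
  have := @mean_value_estimate R (u i) (fun t => f (u^~ t) i) s t 0 M st.
  rewrite mulr0 subr0; apply=> x /andP[sx xt].
    by apply: ud; lra.
  by rewrite subr0; apply: fM => j; apply: uK1; lra.
have [l lP] := choice ex.
(* On a time interval of length tau no coordinate moves by more than 1/2, so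
   the restarted solution remains in the range where clamping does nothing. *)
pose tau := (2 * (M + 1))^-1.
have tau0 : 0 < tau by rewrite invr_gt0; lra.
have tauM : M * tau <= 1 / 2.
  have : tau * (2 * (M + 1)) = 1 by rewrite mulVf// gt_eqF//; lra.
  by rewrite mulrCA mulrDr mulr1 (mulrC tau); lra.
have lK i : `|l i| <= K + 1 / 2.
  pose t := Num.max (T / 2) (T - tau).
  have [t0 tT] : 0 < t /\ t < T.
    by rewrite lt_max gt_max; split; [apply/orP; left|apply/andP; split]; lra.
  have h1 := lP i t t0 tT; have h2 := uK t t0 tT i.
  have h3 : M * (T - t) <= M * tau.
    rewrite ler_wpM2l// lerBlDr -lerBlDl /t le_max; apply/orP; right; lra.
  have := ler_normB (u i t) (u i t - l i).
  by rewrite subKr; lra.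
pose F v i := f (fun j => clamp K1 (v j)) i.
have Fc : coordwise_continuous F.
  move=> v eps eps0; have [d d0 dP] := fc (fun j => clamp K1 (v j)) eps eps0.
  exists d => // v' v'v i; apply: dP => j.
  exact: le_trans (clamp_lip _ _ _) (v'v j).
have FM v i : `|F v i| <= M by apply: fM => j; exact: clamp_bound.
have [v [v0 vM vP]] := @peano R I F l M Fc M0 FM.
have vK t i : 0 <= t -> t <= tau -> `|v t i| <= K1.
  move=> t0 ttau; have := vM t i t0; have := lK i => h1 h2.
  have h3 : M * t <= M * tau by rewrite ler_wpM2l.
  have := ler_normD (v t i - l i) (l i).
  by rewrite subrK; lra.
have Fv t : 0 <= t -> t <= tau -> F (v t) = f (v t).
  move=> t0 tt; apply/funext => i; rewrite /F; congr (f _ i).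
  by apply/funext => j; rewrite clamp_id// vK.
exists (T + tau); first by rewrite ltrDl.
pose g i t := if t < T then u i t else v (t - T) i.
have gu t i : t < T -> g i t = u i t by rewrite /g => ->.
have gv t i : T <= t -> g i t = v (t - T) i by rewrite /g leNgt => /negbTE ->.
exists g; split=> [t tT i|t t0 tT' i]; first exact: gu.
have [tT|Tt] := ltP t T.
  have -> : g^~ t = u^~ t by apply/funext => j; rewrite gu.
  apply: near_eq_is_derive (ud t t0 tT i).
  by near=> s; rewrite gu//; near: s; exact: lt_nbhsl.
have -> : g^~ t = v (t - T) by apply/funext => j; rewrite gv.
rewrite -Fv; [|by lra|by lra].
apply: is_derive_eps => eps eps0.
have [d1 d10 d1P] : exists2 d, 0 < d & forall s, T <= s -> `|s - t| < d ->
    `|g i s - g i t - (s - t) * F (v (t - T)) i| <= eps * `|s - t|.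
  have [||d d0 dP] := vP (t - T) i eps; [by lra|by []|].
  exists d => // s Ts std.
  have e : s - T - (t - T) = s - t by ring.
  have := dP (s - T); rewrite e !gv//; apply; [by lra|exact: ltW].
have [d2 d20 d2P] : exists2 d, 0 < d & forall s, s < T -> `|s - t| < d ->
    `|g i s - g i t - (s - t) * F (v (t - T)) i| <= eps * `|s - t|.
  move: Tt; rewrite le_eqVlt => /orP[/eqP tT|Tt]; last first.
    exists (t - T); first by rewrite subr_gt0.
    by move=> s sT; rewrite ltr_norml => /andP[? ?]; exfalso; lra.
  (* the left derivative at T *)
  rewrite -tT subrr gv// subrr v0 (Fv _ (lexx 0) (ltW tau0)).
  have -> : v 0 = l by apply/funext => j; exact: v0.
  have [|d d0 dP] := @left_limit_slope R (u i) (fun s => f (u^~ s) i) T M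
    (f l i) (l i) M0 T0 (fun s s0 sT => ud s s0 sT i) (lP i) _ eps eps0.
    move=> eps' eps'0; have [d d0 dP] := fc l eps' eps'0.
    have M1 : 0 < M + 1 by rewrite ltr_wpDl.
    exists (d / (M + 1)); first by rewrite divr_gt0.
    move=> s s0 sT; rewrite ltr_pdivlMr// => sd; apply: dP => j.
    apply: le_trans (lP j s s0 sT) _; apply: le_trans (ltW sd).
    by rewrite mulrC ler_pM2l ?subr_gt0// lerDl.
  exists d => // s sT; rewrite distrC gtr0_norm ?subr_gt0// gu//; exact: dP.
exists (Num.min d1 d2); first by rewrite lt_min d10.
move=> s; rewrite lt_min => /andP[sd1 sd2].
by have [/d2P|/d1P] := ltP s T; exact.
Unshelve. all: by end_near. Qed.

(** The neighbourhood filter of v for the sup distance.  It lets the continuity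
    in [coordwise_continuous] be proved by the limit theorems for filters. *)
Definition coord_nbhs (R : realType) (I : finType) (v : I -> R)
    : set_system (I -> R) :=
  filter_from [set d : R | 0 < d]%classic
    (fun d => [set v' : I -> R | forall i, `|v' i - v i| <= d]%classic).

Lemma coord_nbhs_filter (R : realType) (I : finType) (v : I -> R) :
  Filter (coord_nbhs v).
Proof.
apply: filter_from_filter; first by exists 1 => /=.
move=> a b /= a0 b0; exists (Num.min a b); first by rewrite /= lt_min a0.
by move=> v' /= H; split=> i; have := H i; rewrite le_min => /andP[].
Qed.
#[local] Existing Instance coord_nbhs_filter.

Lemma cvg_coord (R : realType) (I : finType) (v : I -> R) (i : I) :
  (v' i @[v' --> coord_nbhs v] --> v i)%classic.
Proof.
apply/(@cvgrPdist_le _ R^o) => eps eps0; exists eps => //= v' H.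
by rewrite distrC.
Qed.

Lemma coordwise_continuousP (R : realType) (I : finType)
    (f : (I -> R) -> I -> R) :
  (forall v i, (f v' i @[v' --> coord_nbhs v] --> f v i)%classic) ->
  coordwise_continuous f.
Proof.
move=> H v eps eps0.
have : (\forall v' \near coord_nbhs v,
    forall i, `|f v' i - f v i| <= eps)%classic.
  apply: filter_forall => i.
  exact: (@cvgr_distC_le _ R^o) (H v i) _ eps0.
by case=> d /= d0 dP; exists d.
Qed.

Lemma ler_norm_spow (R : realType) (r a b : R) : -1 < r -> `|a| <= b ->
  `|spow r a| <= spow r b.
Proof.
move=> r1 ab; rewrite norm_spow// -ge0_spowE//; exact: ler_spow.
Qed.

(** * Elimination of the boundary values *)

Section Network.
Variables (R : realType) (V : finType) (e : rel V) (w : V -> V -> R)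
  (S : {set V}) (mu sigma : V -> R) (p q lambda : R).

(** The boundary condition at z is the equation of a weighted mean of the values
    at the vertices of S and of the constant 0, the latter with weight sigma(z).
    As z is not in S, the vertex z itself can stand for that constant: it carries
    the weight sigma(z), and [inner_part] gives it the value 0. *)
Definition boundary_weight (z y : V) : R :=
  if y \in S then mu z * w z y else if y == z then sigma z else 0.

Definition inner_part (v : V -> R) (x : V) : R := if x \in S then v x else 0.

(** The extension of an interior state by the boundary values that the boundary
    condition forces on it. *)
Definition fill_boundary (v : V -> R) (x : V) : R :=
  if x \in S then v x else pmean (p - 2) (boundary_weight x) (inner_part v).

(** The autonomous system for the interior state; it vanishes outside S so that
    all vertices of V can serve as coordinates. *)
Definition reaction_diffusion (v : V -> R) (x : V) : R :=
  if x \in S then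
    plaplacian e w S p (fill_boundary v) x + lambda * spow (q - 1) (v x)
  else 0.

Hypotheses (hG : is_network e w)
  (hmu : {in boundary e S, forall z, 0 <= mu z})
  (hsigma : {in boundary e S, forall z, 0 <= sigma z})
  (hmusigma : {in boundary e S, forall z, 0 < mu z + sigma z}).

Lemma boundary_notin z : z \in boundary e S -> z \notin S.
Proof. by rewrite !inE => /andP[]. Qed.

(** If sigma(z) = 0 then mu(z) > 0, and z has a neighbour in S by definition of
    the boundary. *)
Lemma weights_boundary_weight z :
  z \in boundary e S -> weights (boundary_weight z).
Proof.
move=> zb; have zS := boundary_notin zb.
have := zb; rewrite !inE => /andP[_ /existsP[y /andP[yS eyz]]].
have m0 : 0 <= mu z := hmu zb.
have s0 : 0 <= sigma z := hsigma zb.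
have ms : 0 < mu z + sigma z := hmusigma zb.
split=> [x|].
  rewrite /boundary_weight; case: ifP => _; last by case: ifP.
  by rewrite mulr_ge0// (weight_ge0 hG).
have [s1|s1] := ltP 0 (sigma z).
  by exists z; rewrite /boundary_weight (negbTE zS) eqxx.
exists y; rewrite /boundary_weight yS; apply: mulr_gt0.
  by lra.
by rewrite (weight_gt0 hG) (adj_sym hG).
Qed.

Lemma wspow_boundary_weight (v : V -> R) z s : z \in boundary e S ->
  wspow (p - 2) (boundary_weight z) (inner_part v) s =
  mu z * (\sum_(y in S) spow (p - 2) (s - v y) * w z y)
  + sigma z * spow (p - 2) s.
Proof.
move=> zb; have zS := boundary_notin zb.
rewrite /wspow (bigID (mem S))/=; congr (_ + _).
  rewrite mulr_sumr; apply: eq_bigr => y yS.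
  by rewrite /boundary_weight /inner_part yS; ring.
rewrite (bigD1 z)//= big1 => [|y /andP[yS yz]].
  by rewrite /boundary_weight /inner_part (negbTE zS) eqxx subr0 addr0.
by rewrite /boundary_weight (negbTE yS) (negbTE yz) mul0r.
Qed.

Hypotheses (hp : 1 < p < 2) (hq : 0 < q) (hlambda : 0 < lambda).

Let p1 : -1 < p - 2. Proof. by move: hp => /andP[? ?]; lra. Qed.
Let q1 : -1 < q - 1. Proof. by move: hq => ?; lra. Qed.

Lemma boundary_conditionE (u : V -> R) z : z \in boundary e S ->
  mu z * pnormal_derivative w S p u z + sigma z * (`|u z| `^ (p - 2) * u z) = 0
  <-> fill_boundary u z = u z.
Proof.
move=> zb; have zS := boundary_notin zb; have wz := weights_boundary_weight zb.
rewrite -/(spow _ _) /pnormal_derivative -wspow_boundary_weight//.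
rewrite /fill_boundary (negbTE zS).
split=> [|<-]; first exact: pmean_eq.
exact: pmeanP.
Qed.

Lemma fill_boundary_inner v : fill_boundary (inner_part v) = fill_boundary v.
Proof.
apply/funext => x; rewrite /fill_boundary; case: ifP => xS.
  by rewrite /inner_part xS.
by congr pmean; apply/funext => y; rewrite /inner_part; case: (y \in S).
Qed.

Lemma fill_boundary_idem v : fill_boundary (fill_boundary v) = fill_boundary v.
Proof.
rewrite -fill_boundary_inner -[RHS]fill_boundary_inner; congr fill_boundary.
apply/funext => x.
by rewrite /inner_part /fill_boundary; case: (x \in S).
Qed.

Lemma plaplacianE (u : V -> R) x : plaplacian e w S p u x =
  \sum_(y in clos e S) spow (p - 2) (u y - u x) * clos_weight w S x y.
Proof. by apply: eq_bigr => y _; rewrite distrC. Qed.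

Lemma eq_plaplacian (u v : V -> R) x : x \in clos e S ->
  {in clos e S, u =1 v} -> plaplacian e w S p u x = plaplacian e w S p v x.
Proof.
by move=> xS uv; rewrite !plaplacianE; apply: eq_bigr => y yS; rewrite !uv.
Qed.

Lemma mem_clos x : x \in S -> x \in clos e S.
Proof. by rewrite inE => ->. Qed.

Lemma clos_boundary x : x \in clos e S -> x \notin S -> x \in boundary e S.
Proof. by rewrite inE => /orP[->|]. Qed.

Lemma cvg_fill_boundary v x : x \in clos e S ->
  (fill_boundary v' x @[v' --> coord_nbhs v] --> fill_boundary v x)%classic.
Proof.
move=> xc; rewrite /fill_boundary; case: ifPn => xS; first exact: cvg_coord.
have wx := weights_boundary_weight (clos_boundary xc xS).
apply: (@cvg_pmean _ _ _ _ _ _ _ _ _ _ (fun=> 1)) => //; first exact: nearW.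
move=> s; rewrite -[wspow _ _ _ s]mul1r; apply: cvgM; first exact: cvg_cst.
apply: cvg_wspow => //; first exact: cvg_cst.
move=> y; rewrite /inner_part; case: ifP => _; first exact: cvg_coord.
exact: cvg_cst.
Qed.

Lemma continuous_reaction_diffusion : coordwise_continuous reaction_diffusion.
Proof.
apply: coordwise_continuousP => v x.
rewrite /reaction_diffusion; case: ifP => xS; last first.
  exact: cvg_cst.
apply: cvgD; last first.
  apply: cvgM; first exact: cvg_cst.
  apply: (@continuous_cvg _ _ _ _ _ (fun v : V -> R => v x) (spow (q - 1))).
    exact: continuous_spow.
  exact: cvg_coord.
under eq_fun do rewrite plaplacianE; rewrite plaplacianE.
apply: cvg_sumr => y yc; apply: cvgM; last exact: cvg_cst.
apply: (@continuous_cvg _ _ _ _ _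
  (fun v => fill_boundary v y - fill_boundary v x) (spow (p - 2))).
  exact: continuous_spow.
by apply: cvgB; apply: cvg_fill_boundary => //; exact: mem_clos.
Qed.

Lemma bounded_reaction_diffusion : coordwise_bounded reaction_diffusion.
Proof.
move=> K; pose B x := \sum_(y in clos e S)
  spow (p - 2) (2 * `|K|) * clos_weight w S x y + lambda * spow (q - 1) `|K|.
have cw0 x y : 0 <= clos_weight w S x y.
  by rewrite /clos_weight; case: ifP => // _; exact: weight_ge0 hG _ _.
have B0 x : 0 <= B x.
  rewrite addr_ge0//; last first.
    by rewrite mulr_ge0 ?(ltW hlambda)// ge0_spowE ?powR_ge0.
  by apply: sumr_ge0 => y _; rewrite mulr_ge0// ge0_spowE ?powR_ge0// mulr_ge0.
exists (\sum_x B x) => v vK x.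
have {}vK y : `|v y| <= `|K| by exact: le_trans (vK y) (ler_norm _).
apply: (@le_trans _ _ (B x)); last first.
  by rewrite (bigD1 x)//= lerDl sumr_ge0.
rewrite /reaction_diffusion; case: ifP => xS; last by rewrite normr0.
have eK y : y \in clos e S -> `|fill_boundary v y| <= `|K|.
  move=> yc; rewrite /fill_boundary; case: ifPn => yS; first exact: vK.
  apply: pmean_bound => //.
    exact: weights_boundary_weight (clos_boundary yc yS).
  by move=> y'; rewrite /inner_part; case: ifP => // _; rewrite normr0.
apply: le_trans (ler_normD _ _) _; apply: lerD; last first.
  by rewrite normrM gtr0_norm// ler_pM2l// ler_norm_spow.
rewrite plaplacianE; apply: le_trans (ler_norm_sum _ _ _) _.
apply: ler_sum => y yc; rewrite normrM [`|clos_weight _ _ _ _|]ger0_norm//.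
rewrite ler_wpM2r// ler_norm_spow//.
apply: le_trans (ler_normB _ _) _; rewrite mulr2n mulrDl mul1r.
by apply: lerD; apply: eK => //; exact: mem_clos.
Qed.

Lemma solution_fill_boundary u0 Tmax u t :
  is_solution e w S mu sigma p q lambda u0 Tmax u ->
  0 <= t -> (t%:E < Tmax)%E ->
  {in clos e S, forall x, fill_boundary (u^~ t) x = u x t}.
Proof.
move=> hu t0 tT x xc; have [xS|xS] := boolP (x \in S).
  by rewrite /fill_boundary xS.
have xb := clos_boundary xc xS.
by apply/(boundary_conditionE (u^~ t) xb); exact: sol_boundary hu _ xb _ t0 tT.
Qed.

(** The interior part of u solves the reduced system and is continued as such;
    the boundary values are then refilled.  They agree with u before T because
    the boundary condition determines them. *)
Lemma bounded_solution_extends u0 T u K : 0 < T ->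
  is_solution e w S mu sigma p q lambda u0 T%:E u ->
  (forall x t, x \in S -> 0 < t -> t < T -> `|u x t| <= K) ->
  exists2 T', T < T' & exists2 v,
    is_solution e w S mu sigma p q lambda u0 T'%:E v &
    {in clos e S, forall x t, time_interval T%:E t -> v x t = u x t}.
Proof.
move=> T0 hu uK.
pose U x t := inner_part (u^~ t) x.
have Ud t : 0 < t -> t < T -> forall x,
    is_derive t 1 (U x) (reaction_diffusion (U^~ t) x).
  move=> t0 tT x; rewrite /reaction_diffusion /U; case: ifPn => xS; last first.
    have -> : (fun t => inner_part (u^~ t) x) = cst 0.
      by apply/funext => s; rewrite /inner_part (negbTE xS).
    exact: is_derive_cst.
  have -> : (fun t => inner_part (u^~ t) x) = u x.
    by apply/funext => s; rewrite /inner_part xS.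
  have xc := mem_clos xS.
  split; first exact: sol_derivable hu _ xc _ t0 _.
  rewrite -derive1E (sol_equation hu xS t0)//.
  rewrite [in RHS]/inner_part xS; congr (_ + _).
  apply: eq_plaplacian => // y yc.
  rewrite -/(inner_part (u^~ t)) fill_boundary_inner.
  by rewrite (solution_fill_boundary hu (ltW t0)).
have UK t : 0 < t -> t < T -> forall x, `|U x t| <= `|K|.
  move=> t0 tT x; rewrite /U /inner_part; case: ifP => xS; last first.
    by rewrite normr0.
  by apply: le_trans (uK x t xS t0 tT) (ler_norm _).
have [T' TT' [g [gU gd]]] := bounded_continuation
  continuous_reaction_diffusion bounded_reaction_diffusion T0 Ud UK.
pose v x t := fill_boundary (g^~ t) x.
have vS x : x \in S -> v x = g x.
  by move=> xS; apply/funext => t; rewrite /v /fill_boundary xS.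
have vE t : fill_boundary (v^~ t) = v^~ t by exact: fill_boundary_idem.
have vu x t : x \in clos e S -> time_interval T%:E t -> v x t = u x t.
  move=> xc [t0 tT]; rewrite -(solution_fill_boundary hu t0 tT xc) /v.
  rewrite -(fill_boundary_inner (u^~ t)).
  by congr fill_boundary; apply/funext => y; rewrite gU.
have vd x t : x \in clos e S -> 0 < t -> t < T' -> derivable (v x) t 1.
  move=> xc t0 tT; have gd' y : derivable (g y) t 1 by have [] := gd t t0 tT y.
  have [xS|xS] := boolP (x \in S); first by rewrite vS.
  rewrite /v /fill_boundary (negbTE xS).
  apply: (@derivable_pmean _ _ _ _ (fun t => inner_part (g^~ t))).
  - by move: hp => /andP[? ?]; apply/andP; split; lra.
  - exact: weights_boundary_weight (clos_boundary xc xS).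
  - move=> y; rewrite /inner_part; case: (y \in S); last exact: derivable_cst.
    exact: gd'.
exists T' => //; exists v; last by move=> x xc t; exact: vu.
split.
- move=> x xc; apply/subspace_continuousP => t [t0 tT].
  move: t0; rewrite le_eqVlt => /orP[/eqP t0|t0]; last first.
    apply: cvg_within_filter.
    by apply/differentiable_continuous/derivable1_diffP/vd.
  have i0 : time_interval T%:E 0 by split; rewrite /= ?lte_fin.
  rewrite -t0 /from_subspace (vu _ _ xc i0).
  have /subspace_continuousP uc := sol_continuous hu xc.
  have := uc 0 i0.
  rewrite /from_subspace; apply: cvg_trans.
  (* Near time 0 the two functions and the two intervals coincide. *)
  move=> P h.
  have {}h : (\forall s \near (0 : R),
    time_interval T%:E s -> P (u x s))%classic by exact: h.
  suff : (\forall s \near (0 : R),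
    time_interval T'%:E s -> P (v x s))%classic by [].
  near=> s => -[s0 _].
  have sT : s < T by near: s; exact: lt_nbhsl.
  have As : time_interval T%:E s by split; rewrite ?lte_fin.
  by rewrite vu//; move: As; near: s; exact: h.
- move=> x xc t t0 tT; exact: vd.
- move=> x xS t t0 tT; rewrite vS// derive1E.
  have [_ ->] := gd t t0 tT x; rewrite /reaction_diffusion xS; congr (_ + _).
- move=> z zb t t0 tT.
  by apply/(boundary_conditionE (v^~ t) zb); rewrite vE.
- by move=> x xc; rewrite vu//; exact: sol_initial hu _ xc.
Unshelve. all: by end_near. Qed.
End Network.

(** * Energy and extinction *)
Lemma clos_weight_sym (R : realType) (V : finType) (e : rel V)
    (w : V -> V -> R) (S : {set V}) x y : is_network e w ->
  clos_weight w S x y = clos_weight w S y x.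
Proof. by move=> hG; rewrite /clos_weight orbC (weight_sym hG). Qed.

Lemma sum_clos (R : realType) (V : finType) (e : rel V) (S : {set V})
    (F : V -> R) :
  \sum_(x in clos e S) F x = \sum_(x in S) F x + \sum_(x in boundary e S) F x.
Proof.
rewrite (big_setID S)/=; congr (_ + _); apply: eq_bigl => x.
  by rewrite !inE; case: (x \in S); rewrite ?andbT ?andbF.
by rewrite !inE; case: (x \in S).
Qed.

(** Both sides equal the sum over all pairs of u(x) T(x,y), T(x,y) =
    |u(x)-u(y)|^(p-2) (u(x)-u(y)) w(x,y): the left one by antisymmetry of T, the
    right one by sorting the pairs according to whether x lies in S or on the
    boundary. *)
Lemma green_formula (R : realType) (V : finType) (e : rel V)
    (w : V -> V -> R) (S : {set V}) (p : R) (u : V -> R) : 1 < p ->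
  is_network e w ->
  2^-1 * (\sum_(x in clos e S) \sum_(y in clos e S)
            `|u x - u y| `^ p * clos_weight w S x y) =
  - (\sum_(x in S) u x * plaplacian e w S p u x)
  + \sum_(z in boundary e S) u z * pnormal_derivative w S p u z.
Proof.
move=> p1 hG; pose T x y := spow (p - 2) (u x - u y) * clos_weight w S x y.
have Tsym x y : T x y = - T y x.
  by rewrite /T -(opprB (u y)) spowN mulNr (clos_weight_sym _ _ _ hG).
transitivity (\sum_(x in clos e S) u x * \sum_(y in clos e S) T x y);
  last first.
  rewrite sum_clos -sumrN; congr (_ + _); apply: eq_bigr => x xS.
    rewrite -mulrN plaplacianE -sumrN; congr (_ * _); apply: eq_bigr => y _.
    by rewrite Tsym /T (clos_weight_sym S y x hG).
  congr (_ * _); rewrite sum_clos [X in _ + X]big1 ?addr0 => [|y yb].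
    by apply: eq_bigr => y yS; rewrite /T /clos_weight yS orbT.
  rewrite /T /clos_weight (negbTE (boundary_notin xS)).
  by rewrite (negbTE (boundary_notin yb)) mulr0.
under [RHS]eq_bigr do rewrite mulr_sumr.
set A := RHS.
have A' : A = \sum_(x in clos e S) \sum_(y in clos e S) - (u y * T x y).
  rewrite /A exchange_big; apply: eq_bigr => x _; apply: eq_bigr => y _.
  by rewrite Tsym mulrN.
suff -> : \sum_(x in clos e S) \sum_(y in clos e S)
    `|u x - u y| `^ p * clos_weight w S x y = A + A.
  by field.
rewrite {2}A' -big_split; apply: eq_bigr => x _; rewrite -big_split.
apply: eq_bigr => y _; rewrite /= -mulrBl /T mulrA mulr_spow ?subrK//.
lra.
Qed.

(** Where mu(z) > 0 the boundary condition expresses the normal derivative by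
    u(z), which produces the boundary part of the energy; where mu(z) = 0 it
    forces u(z) = 0, which makes u a competitor for the first eigenvalue. *)
Lemma green_energy (R : realType) (V : finType) (e : rel V)
    (w : V -> V -> R) (S : {set V}) (mu sigma : V -> R) (p : R) (u : V -> R) :
  1 < p -> is_network e w ->
  {in boundary e S, forall z, 0 <= mu z} ->
  {in boundary e S, forall z, 0 < mu z + sigma z} ->
  {in boundary e S, forall z, mu z * pnormal_derivative w S p u z
    + sigma z * (`|u z| `^ (p - 2) * u z) = 0} ->
  {in boundary e S :\: Gam e S mu, forall z, u z = 0} /\
  \sum_(x in S) u x * plaplacian e w S p u x = - penergy e w S mu sigma p u.
Proof.
move=> p1 hG hmu hms bc.
have u0 : {in boundary e S :\: Gam e S mu, forall z, u z = 0}.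
  move=> z; rewrite finset.in_setD => /andP[h zb].
  have mz : mu z = 0.
    apply/eqP; rewrite eq_le hmu// andbT leNgt; apply/negP => m0.
    by move: h; rewrite inE zb m0.
  have := bc z zb; rewrite mz mul0r add0r => /eqP; rewrite mulf_eq0.
  have := hms z zb; rewrite mz add0r => s0; rewrite gt_eqF//=.
  by apply: contraTeq; exact: spow_neq0.
split=> //.
rewrite /penergy green_formula//.
suff -> : \sum_(z in boundary e S) u z * pnormal_derivative w S p u z =
    - \sum_(z in Gam e S mu) sigma z / mu z * `|u z| `^ p.
  by rewrite subrK opprK.
rewrite (big_setID (Gam e S mu))/= [X in _ + X]big1 ?addr0 => [|z /u0 ->].
2: by rewrite mul0r.
have -> : boundary e S :&: Gam e S mu = Gam e S mu.
  by apply/finset.setIidPr/fintype.subsetP => z; rewrite !inE => /andP[].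
rewrite -sumrN; apply: eq_bigr => z; rewrite inE => /andP[zb m0].
have := bc z zb; rewrite -/(spow (p - 2) (u z)) => h.
have hu : `|u z| `^ p = u z * spow (p - 2) (u z).
  by rewrite mulr_spow ?subrK//; lra.
have -> : pnormal_derivative w S p u z
    = - (sigma z / mu z * spow (p - 2) (u z)).
  have m1 : mu z != 0 by rewrite gt_eqF.
  apply: (mulfI m1).
  have -> : mu z * - (sigma z / mu z * spow (p - 2) (u z)) =
    - (sigma z * spow (p - 2) (u z)) by field.
  by apply/eqP; rewrite -addr_eq0 h.
by rewrite hu; ring.
Qed.

Lemma powR_sqr (R : realType) (a r : R) : (a ^+ 2) `^ (r / 2) = `|a| `^ r.
Proof.
rewrite -real_normK ?num_real// -(powR_mulrn 2)// -powRrM.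
by congr powR; field.
Qed.

(** Each |u(x)|^r is at most the factor in front, as u(x)^2 is a term of the sum
    of squares. *)
Lemma sum_powR_le (R : realType) (I : finType) (A : {set I}) (u : I -> R)
    (r s : R) : 0 <= r -> 0 < s ->
  \sum_(x in A) `|u x| `^ (r + s) <=
  (\sum_(x in A) u x ^+ 2) `^ (r / 2) * \sum_(x in A) `|u x| `^ s.
Proof.
move=> r0 s0; rewrite mulr_sumr; apply: ler_sum => x xA.
rewrite powRD; last by apply/implyP => /eqP ?; exfalso; lra.
rewrite ler_wpM2r ?powR_ge0// -powR_sqr.
apply: ge0_ler_powR; rewrite ?nnegrE ?sqr_ge0//.
- by rewrite divr_ge0.
- by apply: sumr_ge0 => y _; rewrite sqr_ge0.
by rewrite (bigD1 x)//= lerDl sumr_ge0// => y _; rewrite sqr_ge0.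
Qed.

Lemma rayleigh_bound (R : realType) (V : finType) (e : rel V)
    (w : V -> V -> R) (S : {set V}) (mu sigma : V -> R) (p : R) (u : V -> R) :
  is_network e w -> S != finset.set0 ->
  {in boundary e S, forall z, 0 <= sigma z} -> 0 < p ->
  {in boundary e S :\: Gam e S mu, forall z, u z = 0} ->
  first_eigenvalue e w S mu sigma p * \sum_(x in S) `|u x| `^ p
    <= penergy e w S mu sigma p u.
Proof.
move=> hG S0 hs p0 u0.
have [ex|nex] := pselect (exists2 x, x \in S & u x != 0).
  have [u1 _ [<- /(_ u (conj ex u0))]] := first_eigenvalue_min mu hG S0 hs p0.
  rewrite {2}/rayleigh ler_pdivlMr//; case: ex => x xS ux.
  rewrite (bigD1 x)//= ltr_wpDr ?sumr_ge0//.
  by rewrite powR_gt0 // normr_gt0.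
rewrite big1 ?mulr0 => [|x xS].
  apply: addr_ge0.
    rewrite mulr_ge0//; apply: sumr_ge0 => x _; apply: sumr_ge0 => y _.
    rewrite mulr_ge0 ?powR_ge0// /clos_weight.
    by case: ifP => // _; exact: weight_ge0 hG _ _.
  apply: sumr_ge0 => z; rewrite inE => /andP[zb mz].
  by rewrite mulr_ge0 ?powR_ge0// divr_ge0 ?hs// ltW.
have [->|ux] := eqVneq (u x) 0; first by rewrite normr0 powR0// gt_eqF.
by case: nex; exists x.
Qed.

Lemma is_derive_spow1 (R : realType) (x : R) :
  is_derive x 1 (spow 1) (2 * `|x|).
Proof.
have [->|x0] := eqVneq x 0.
  apply: is_derive_eps => eps eps0; exists eps => // s.
  rewrite normr0 mulr0 mulr0 !subr0 spow0 subr0 /spow powRr1// normrM normr_id.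
  by move=> /ltW h; rewrite ler_wpM2r.
by have := is_derive_spow 1 x0; rewrite powRr1.
Qed.

(** The map x |-> x^2 + |x| x is twice the square of the positive part of x.  Its
    composition with a - y has a nonnegative derivative at all times, whether y
    is below a or not, so (a - y)^+ never drops below its initial value. *)
Lemma nonincreasing_below (R : realType) (y y' : R -> R) (a t : R) : 0 < t ->
  {within `[0, t], continuous y}%classic ->
  (forall s : R, 0 < s -> s < t -> is_derive s 1 y (y' s)) ->
  (forall s : R, 0 < s -> s < t -> y s < a -> y' s <= 0) ->
  y 0 < a -> y t <= y 0.
Proof.
move=> t0 yc yd yn y0a.
pose phi x : R := x * x + spow 1 x.
have phid (x : R) : is_derive x 1 phi (2 * (x + `|x|)).
  have id1 := is_derive_id x (1 : R).
  have h := is_deriveD (is_deriveM id1 id1) (is_derive_spow1 x).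
  by apply: is_derive_eq h _; rewrite /GRing.scale /= mulr1; ring.
have zd (s : R) : s \in `]0, t[ -> is_derive s 1 (fun s : R => phi (a - y s))
    (2 * ((a - y s) + `|a - y s|) * - y' s).
  rewrite in_itv /= => /andP[s0 st].
  have h := is_deriveB (is_derive_cst a s 1) (yd s s0 st).
  rewrite sub0r in h.
  exact: (is_derive1_comp (f := phi) (phid _) h).
have [|c] := MVT t0 zd.
  apply/subspace_continuousP => s s0t.
  have /subspace_continuousP/(_ s s0t) ys := yc.
  apply: (@continuous_cvg _ _ _ _ _ (fun s => a - y s) phi).
    apply/differentiable_continuous/derivable1_diffP.
    by have [] := phid (a - y s).
  by apply: cvgB => //; exact: cvg_cst.
rewrite in_itv /= => /andP[c0 ct] e.
have phi_le : phi (a - y 0) <= phi (a - y t).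
  rewrite -subr_ge0 e subr0 mulr_ge0 ?(ltW t0)//.
  have [ya|ya] := ltP (y c) a.
    by rewrite mulr_ge0 ?oppr_ge0 ?yn// mulr_ge0// addr_ge0// subr_ge0 ltW.
  by rewrite ler0_norm ?subr_le0// subrr mulr0 mul0r.
rewrite leNgt; apply/negP => yt0; move: phi_le; apply/negP; rewrite -ltNge.
rewrite /phi /spow !powRr1// [`|a - y 0|]gtr0_norm ?subr_gt0//.
have [ya|ya] := ltP (y t) a.
  by rewrite gtr0_norm ?subr_gt0//; nra.
by rewrite ler0_norm ?subr_le0//; nra.
Qed.

Lemma is_derive_sumr (R : realType) (I : finType) (P : pred I)
    (f : I -> R -> R) (df : I -> R) (t : R) :
  (forall i, P i -> is_derive t 1 (f i) (df i)) ->
  is_derive t 1 (fun s => \sum_(i | P i) f i s) (\sum_(i | P i) df i).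
Proof.
move=> h; rewrite (_ : (fun s => _) = \sum_(i | P i) f i); last first.
  by apply/funext => s; rewrite fct_sumE.
by elim/big_ind2 : _ => // [|] *; [exact: is_derive_cst|exact: is_deriveD].
Qed.

(** The hypothesis bounds the derivative of y^a by - a c. *)
Lemma extinction (R : realType) (y y' : R -> R) (a c : R) : 0 < a -> 0 < c ->
  (forall t : R, 0 < t -> is_derive t 1 y (y' t)) ->
  (forall t : R, 0 < t -> 0 <= y t) ->
  (forall t : R, 0 < t -> 0 < y t -> y t `^ (a - 1) * y' t <= - c) ->
  exists2 t, 0 < t & y t = 0.
Proof.
move=> a0 c0 yd y_ge0 H; apply: contrapT => no.
have y0 t : 0 < t -> 0 < y t.
  move=> t0; rewrite lt_neqAle y_ge0// andbT eq_sym; apply/eqP => yt.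
  by apply: no; exists t.
pose T := y 1 `^ a / (a * c) + 1.
have ac0 : 0 < a * c by rewrite mulr_gt0.
have T0 : 0 < T by rewrite ltr_wpDl// divr_ge0 ?powR_ge0// ltW.
have zd (t : R) : 0 < t ->
    is_derive t 1 (fun t => y t `^ a) (a * y t `^ (a - 1) * y' t).
  move=> t0.
  exact: (is_derive1_comp (f := fun x : R => x `^ a)
    (is_derive1_powR a (y0 t t0)) (yd t t0)).
have [|||s] := @MVT R (fun t => y t `^ a)
    (fun t => a * y t `^ (a - 1) * y' t) 1 (1 + T).
- by rewrite ltrDl.
- by move=> s; rewrite in_itv /= => /andP[s1 _]; apply: zd; lra.
- apply: derivable_within_continuous => s; rewrite in_itv /= => /andP[s1 _].
  have s0 : 0 < s by lra.
  by have [] := zd s s0.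
rewrite in_itv /= (addrC 1 T) addrK => /andP[s1 _] e.
have s0 : 0 < s by lra.
have z0 : 0 <= y (T + 1) `^ a := powR_ge0 _ _.
have h := H s s0 (y0 s s0).
have h1 : a * y s `^ (a - 1) * y' s * T <= - (a * c) * T.
  rewrite ler_pM2r// -mulrA -mulrN ler_pM2l//.
have h2 : a * c * T = y 1 `^ a + a * c.
  rewrite /T mulrDr mulr1 mulrCA mulfV ?mulr1//.
  by rewrite gt_eqF.
lra.
Qed.

Section Solution.
Variables (R : realType) (V : finType) (e : rel V) (w : V -> V -> R)
  (S : {set V}) (mu sigma : V -> R) (p q lambda : R).
Hypotheses (hG : is_network e w) (hS : S != finset.set0)
  (hmu : {in boundary e S, forall z, 0 <= mu z})
  (hsigma : {in boundary e S, forall z, 0 <= sigma z})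
  (hmusigma : {in boundary e S, forall z, 0 < mu z + sigma z})
  (hp : 1 < p < 2) (hpq : p - 1 < q) (hlambda : 0 < lambda).
Variables (u0 : V -> R) (Tmax : \bar R) (u : V -> R -> R).
Hypothesis hu : is_solution e w S mu sigma p q lambda u0 Tmax u.

Let Y t := \sum_(x in S) u x t ^+ 2.
Let Y' t := 2 * \sum_(x in S) u x t * derive1 (u x) t.
Let lambda0 := first_eigenvalue e w S mu sigma p.

Lemma is_derive_sumsq t : 0 < t -> (t%:E < Tmax)%E -> is_derive t 1 Y (Y' t).
Proof.
move=> t0 tT; rewrite /Y /Y' mulr_sumr; apply: is_derive_sumr => x xS.
have ud : is_derive t 1 (u x) (derive1 (u x) t).
  split; last by rewrite derive1E.
  exact: sol_derivable hu _ (mem_clos _ xS) _ t0 tT.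
have h := is_deriveM ud ud.
apply: is_derive_eq h _; rewrite /GRing.scale /=; ring.
Qed.

Lemma continuous_sumsq T : (T%:E < Tmax)%E ->
  {within `[0, T], continuous Y}%classic.
Proof.
move=> TT; apply/subspace_continuousP => t t0T.
apply: cvg_sumr => x xS.
have /subspace_continuousP/(_ t t0T) ut :
    {within `[0, T], continuous (u x)}%classic.
  apply: continuous_subspaceW (sol_continuous hu (mem_clos e xS)).
  move=> s; rewrite /= in_itv /= => /andP[s0 sT]; split => //.
  by apply: le_lt_trans TT; rewrite lee_fin.
exact: cvgM.
Qed.

Lemma sumsq_dissipation t : 0 < t -> (t%:E < Tmax)%E ->
  Y' t <= - (2 * (lambda0 - lambda * Y t `^ ((q - p + 1) / 2))
                * \sum_(x in S) `|u x t| `^ p).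
Proof.
move=> t0 tT; have /andP[p1 p2] := hp; have pq := hpq.
have [ub green] := green_energy p1 hG hmu hmusigma
  (fun z zb => sol_boundary hu zb (ltW t0) tT).
have ray := rayleigh_bound hG hS hsigma (lt_trans ltr01 p1) ub.
have src : \sum_(x in S) `|u x t| `^ (q - p + 1 + p) <=
    Y t `^ ((q - p + 1) / 2) * \sum_(x in S) `|u x t| `^ p.
  by apply: sum_powR_le; lra.
have -> : Y' t = 2 * (- penergy e w S mu sigma p (u^~ t)
    + lambda * \sum_(x in S) `|u x t| `^ (q - p + 1 + p)).
  rewrite /Y' -green [lambda * _]mulr_sumr -big_split/=; congr (_ * _).
  apply: eq_bigr => x xS; rewrite (sol_equation hu xS t0 tT) mulrDr.
  congr (_ + _); rewrite mulrCA -/(spow (q - 1) (u x t)) mulr_spow; last lra.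
  by congr (_ * (_ `^ _)); ring.
move: src => /(ler_wpM2l (ltW hlambda)).
rewrite -/lambda0 in ray; lra.
Qed.

Hypothesis small :
  lambda * Y 0 `^ ((q - p + 1) / 2) < lambda0.

Lemma sumsq_le t : 0 <= t -> (t%:E < Tmax)%E -> Y t <= Y 0.
Proof.
rewrite le_eqVlt => /orP[/eqP<-//|t0] tT.
have /andP[p1 p2] := hp; have pq := hpq.
pose th := (q - p + 1) / 2.
have th0 : 0 < th by rewrite /th divr_gt0//; lra.
have Y0 s : 0 <= Y s by apply: sumr_ge0 => x _; rewrite sqr_ge0.
have lambda00 : 0 < lambda0.
  by apply: le_lt_trans small; rewrite mulr_ge0 ?powR_ge0// ltW.
(* The level of Y at which the reaction balances the diffusion. *)
pose a := (lambda0 / lambda) `^ th^-1.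
have ath : a `^ th = lambda0 / lambda.
  by rewrite /a -powRrM mulVf ?gt_eqF// powRr1// ltW// divr_gt0.
have aY s : (Y s < a) = (lambda * Y s `^ th < lambda0).
  rewrite mulrC -ltr_pdivlMr// -ath; apply/idP/idP => h.
    by apply: gt0_ltr_powR; rewrite ?nnegrE ?powR_ge0.
  rewrite ltNge; apply/negP => aY; move: h; apply/negP; rewrite -leNgt.
  by apply: ge0_ler_powR; rewrite ?nnegrE ?powR_ge0// ltW.
apply: (@nonincreasing_below R Y Y' a t t0).
- exact: continuous_sumsq.
- move=> s s0 st; apply: is_derive_sumsq => //.
  by apply: lt_trans tT; rewrite lte_fin.
- move=> s s0 st sa; apply: le_trans (sumsq_dissipation s0 _) _.
    by apply: lt_trans tT; rewrite lte_fin.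
  rewrite oppr_le0 mulr_ge0//; last by apply: sumr_ge0 => x _; rewrite powR_ge0.
  by rewrite mulr_ge0// subr_ge0 ltW// -aY.
by rewrite aY.
Qed.

(** By [sum_powR_le] with r = 2 - p, Y <= Y^((2-p)/2) P, that is
    Y^((2-p)/2 - 1) P >= 1, so the factor P disappears from the dissipation. *)
Lemma sumsq_powR_decay t : 0 < t -> (t%:E < Tmax)%E -> 0 < Y t ->
  Y t `^ ((2 - p) / 2 - 1) * Y' t <=
  - (2 * (lambda0 - lambda * Y 0 `^ ((q - p + 1) / 2))).
Proof.
move=> t0 tT Et; have /andP[p1 p2] := hp; have pq := hpq.
set c := lambda0 - _; have c0 : 0 < c by rewrite subr_gt0.
have P0 : 0 <= \sum_(x in S) `|u x t| `^ p.
  by apply: sumr_ge0 => x _; rewrite powR_ge0.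
set P := \sum_(x in S) _ in P0.
have dis : Y' t <= - (2 * c * P).
  apply: le_trans (sumsq_dissipation t0 tT) _.
  rewrite lerN2 ler_wpM2r// ler_pM2l// lerB// ler_pM2l//.
  apply: ge0_ler_powR; rewrite ?nnegrE ?sumsq_le ?(ltW t0) ?(ltW Et)//.
    by rewrite divr_ge0//; lra.
  by apply: sumr_ge0 => x _; rewrite sqr_ge0.
have YP : Y t <= Y t `^ ((2 - p) / 2) * P.
  have : \sum_(x in S) `|u x t| `^ (2 - p + p) <= Y t `^ ((2 - p) / 2) * P.
    by apply: sum_powR_le; lra.
  apply: le_trans; rewrite subrK le_eqVlt; apply/orP; left; apply/eqP.
  by apply: eq_bigr => x _; rewrite powR_mulrn// real_normK// num_real.
have one : 1 <= Y t `^ ((2 - p) / 2 - 1) * P.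
  rewrite -(ler_pM2l Et) mulr1 mulrA mulr_powRB1//; first exact: ltW.
  by rewrite divr_gt0//; lra.
apply: le_trans (ler_wpM2l (powR_ge0 _ _) dis) _.
rewrite mulrN lerN2 mulrCA -[leLHS]mulr1 ler_pM2l// mulr_gt0//.
Qed.

End Solution.

Unset Implicit Arguments.

Theorem theorem3p12 (R : realType) (V : finType) (e : rel V)
    (w : V -> V -> R) (S : {set V}) (mu sigma : V -> R) (p q lambda : R)
    (hG : is_network e w)
    (hS : connected_induced e S)
    (hmu : {in boundary e S, forall z, 0 <= mu z})
    (hsigma : {in boundary e S, forall z, 0 <= sigma z})
    (hmusigma : {in boundary e S, forall z, 0 < mu z + sigma z})
    (hlambda : 0 < lambda)
    (hp0 : 0 < p - 1) (hpq : p - 1 < q)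
    (hp : 1 < p < 2)
    (hsigma0 : exists2 z, z \in boundary e S & sigma z != 0)
    (u0 : V -> R)
    (hu0 : {in clos e S, forall x, 0 <= u0 x})
    (hsmall : lambda * (#|S|%:R `^ (1 / 2))
                * (\sum_(x in S) u0 x ^+ 2) `^ ((q - p + 1) / 2)
              < first_eigenvalue e w S mu sigma p)
    (Tmax : \bar R) (u : V -> R -> R)
    (hu : is_maximal_solution e w S mu sigma p q lambda u0 Tmax u) :
  vanishes_in_finite_time S Tmax u.
Proof.
have [Tmax0 sol maximal] := hu; have [S0 _] := hS.
have /andP[p1 p2] := hp.
have hq : 0 < q by exact: lt_trans hpq.
pose Y t := \sum_(x in S) u x t ^+ 2.
have Y_ge0 t : 0 <= Y t by apply: sumr_ge0 => x _; rewrite sqr_ge0.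
(* The factor |S|^(1/2) of the hypothesis is at least 1. *)
have small : lambda * Y 0 `^ ((q - p + 1) / 2)
    < first_eigenvalue e w S mu sigma p.
  have -> : Y 0 = \sum_(x in S) u0 x ^+ 2.
    by apply: eq_bigr => x xS; rewrite (sol_initial sol (mem_clos e xS)).
  apply: le_lt_trans hsmall; rewrite ler_wpM2r ?powR_ge0//.
  rewrite -[leLHS]mulr1 ler_pM2l//.
  rewrite -[leLHS](congr1 (fun f => f (1 / 2)) (@powR1 R)).
  by apply: ge0_ler_powR; rewrite ?nnegrE// ler1n card_gt0.
have decreasing := sumsq_le hG S0 hmu hsigma hmusigma hp hpq hlambda sol small.
have global : Tmax = +oo%E.
  move: Tmax0 sol maximal decreasing {hu}; case: Tmax => [T| |]//.
  rewrite lte_fin => T0 sol maximal decreasing; exfalso.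
  (* The bound 1 + Y 0 is a cheap upper bound for the square root of Y 0. *)
  have [x t xS t0 tT|T' TT' [v vsol vu]] := bounded_solution_extends
    (K := 1 + Y 0) hG hmu hsigma hmusigma hp hq hlambda T0 sol.
    have xY : u x t ^+ 2 <= Y 0.
      apply: le_trans (decreasing t (ltW t0) _); last by rewrite lte_fin.
      by rewrite (bigD1 x)//= lerDl sumr_ge0// => y _; rewrite sqr_ge0.
    rewrite -real_normK ?num_real// in xY.
    by have := normr_ge0 (u x t); nra.
  by apply: (maximal T'%:E v _ vsol vu); rewrite lte_fin.
move: sol {decreasing}; rewrite global => sol.
have [|||||t t0 Yt] := extinction
  (y := Y) (y' := fun t => 2 * \sum_(x in S) u x t * derive1 (u x) t)
  (a := (2 - p) / 2)
  (c := 2 * (first_eigenvalue e w S mu sigma p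
             - lambda * Y 0 `^ ((q - p + 1) / 2))).
- by rewrite divr_gt0//; lra.
- by rewrite mulr_gt0// subr_gt0.
- move=> t t0; have tT : (t%:E < +oo)%E by rewrite ltry.
  by have dY := is_derive_sumsq sol t0 tT.
- by [].
- move=> t t0 Yt; have tT : (t%:E < +oo)%E by rewrite ltry.
  have decay := sumsq_powR_decay hG S0 hmu hsigma hmusigma hp hpq hlambda.
  by have := decay _ _ _ sol small t t0 tT Yt.
by exists t; split=> //; rewrite ltry.
Qed.
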